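(* ($\mathsf{ZFC}$) Let $2^{<\omega}$ be the frame of finite binary sequences ordered by end-extension, with least element the empty sequence. Then $V^{2^{<\omega}}\vDash\mathsf{NDCom}$. In fact, $V^{2^{<\omega}}\vDash$ ''No set can be a double complement of $\check{V}_\omega$.''
   Context: $\mathsf{NDCom}$ (Axiom of Non-Double Complement): $\exists x\,\forall y\,\neg[\forall z\,(\neg\neg(z\in x)\to z\in y)]$. A set $y$ is a double complement of $x$ if $\forall z\,(z\in y\leftrightarrow\neg\neg(z\in x))$. The Kripke model over a frame $\mathbb{P}$ (a partial order with least element $\bot$), here $\mathbb{P}=2^{<\omega}$: let $\uparrow p=\{q\in\mathbb{P}\mid q\ge p\}$. For an ordinal $\alpha$ and $p\in\mathbb{P}$, $V^{\mathbb{P}}_\alpha(p)$ is defined by recursion as the class of all functions $x$ with domain $\uparrow p$ such that (i) $x(q)\subseteq\bigcup_{\beta\in\alpha}V^{\mathbb{P}}_\beta(q)$ for all $q\ge p$, and (ii) (monotonicity) $\tau_{qr}''[x(q)]\subseteq x(r)$ for all $p\le q\le r$, where $\tau_{qr}(y)=y\upharpoonright(\uparrow r)$ for $y$ with domain $\uparrow q$. Let $V^{\mathbb{P}}(p)=\bigcup_{\alpha\in\mathrm{Ord}}V^{\mathbb{P}}_\alpha(p)$. Forcing: for parameters in $V^{\mathbb{P}}(p)$, $p\Vdash x\in y$ iff $x\in y(p)$; $p\Vdash x=y$ iff $x(q)=y(q)$ for all $q\ge p$; $p\Vdash\phi\land\psi$ iff $p\Vdash\phi$ and $p\Vdash\psi$;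 $p\Vdash\phi\lor\psi$ iff $p\Vdash\phi$ or $p\Vdash\psi$; $p\Vdash\phi\to\psi$ iff for each $q\ge p$, $q\Vdash\phi$ implies $q\Vdash\psi$; $p\Vdash\forall x\,\phi(x)$ iff $q\Vdash\phi(x)$ for each $q\ge p$ and $x\in V^{\mathbb{P}}(q)$; $p\Vdash\exists x\,\phi(x)$ iff $p\Vdash\phi(x)$ for some $x\in V^{\mathbb{P}}(p)$; no $p$ forces falsum, and $\neg\phi$ is $\phi\to$ falsum. A parameter $a\in V^{\mathbb{P}}(r)$ with $r\le q$ is read at node $q$ as $\tau_{rq}(a)$. $V^{\mathbb{P}}\vDash\phi$ means $\bot\Vdash\phi$. For a set $a$, its canonical name $\check a\in V^{\mathbb{P}}(\bot)$ is the function with domain $\mathbb{P}$ given recursively by $\check a(p)=\{\tau_{\bot p}(\check b)\mid b\in a\}$. $V_\omega$ is the set of hereditarily finite sets. *)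

(* Defs.v *)
From Stdlib Require Import List ClassicalEpsilon.

(** * First-order set theory *)

(** Formulas of the language of set theory, with de Bruijn indices:
    variable [0] is the one bound by the innermost quantifier. *)
Inductive form : Type :=
| Mem : nat -> nat -> form
| Eq : nat -> nat -> form
| Fls : form
| And : form -> form -> form
| Or : form -> form -> form
| Imp : form -> form -> form
| All : form -> form
| Ex : form -> form.

Definition Neg (A : form) : form := Imp A Fls.
Definition Iff (A B : form) : form := And (Imp A B) (Imp B A).

(** A first-order structure for the language of set theory. *)
Record structure : Type := Structure {
  carrier :> Type;
  nonempty : inhabited carrier;
  mem : carrier -> carrier -> Prop
}.
Arguments mem {_} _ _.
Notation "x ∈ y" := (mem x y) (at level 70, no associativity).

(** Definite description, and the set having exactly the elements that satisfy
    [Q].  Both are arbitrary when there is no such object. *)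
Definition the {M : structure} (Q : M -> Prop) : M := epsilon (nonempty M) Q.
Definition setof {M : structure} (Q : M -> Prop) : M :=
  the (fun y => forall x, x ∈ y <-> Q x).
Definition emptyset {M : structure} : M := setof (fun _ => False).

(** Tarskian satisfaction; [e] lists the values of the free variables.  The
    default value for variables beyond the end of [e] is immaterial. *)
Definition val {M : structure} (e : list M) (i : nat) : M := nth i e emptyset.

Fixpoint sat {M : structure} (A : form) (e : list M) : Prop :=
  match A with
  | Mem i j => val e i ∈ val e j
  | Eq i j => val e i = val e j
  | Fls => False
  | And B C => sat B e /\ sat C e
  | Or B C => sat B e \/ sat C e
  | Imp B C => sat B e -> sat C e
  | All B => forall x : M, sat B (x :: e)
  | Ex B => exists x : M, sat B (x :: e)
  end.

(** Models of ZFC.  The single axioms are written out in the structure, the two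
    schemas range over first-order formulas with parameters. *)
Record ZFC (M : structure) : Prop := {
  extensionality : forall x y : M, (forall z, z ∈ x <-> z ∈ y) -> x = y;
  foundation : forall x : M,
    (exists y, y ∈ x) -> exists y, y ∈ x /\ forall z, z ∈ y -> ~ z ∈ x;
  pairing : forall x y : M, exists p, forall z, z ∈ p <-> z = x \/ z = y;
  union : forall x : M, exists u, forall z, z ∈ u <-> exists y, y ∈ x /\ z ∈ y;
  powerset : forall x : M,
    exists p, forall z, z ∈ p <-> forall w, w ∈ z -> w ∈ x;
  infinity : exists x : M,
    (exists o, o ∈ x /\ forall z, ~ z ∈ o) /\
    (forall y, y ∈ x -> exists s, s ∈ x /\ forall z, z ∈ s <-> z ∈ y \/ z = y);
  separation : forall (A : form) (e : list M) (a : M),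
    exists b, forall x, x ∈ b <-> x ∈ a /\ sat A (x :: e);
  replacement : forall (A : form) (e : list M) (a : M),
    (forall x, x ∈ a -> exists! y, sat A (x :: y :: e)) ->
    exists b, forall y, y ∈ b <-> exists x, x ∈ a /\ sat A (x :: y :: e);
  choice : forall a : M,
    (forall x, x ∈ a -> exists z, z ∈ x) ->
    (forall x y, x ∈ a -> y ∈ a -> x <> y -> forall z, ~ (z ∈ x /\ z ∈ y)) ->
    exists c, forall x, x ∈ a -> exists! z, z ∈ c /\ z ∈ x
}.

(** * Set-theoretic vocabulary inside a structure *)

Section Vocabulary.
Context {M : structure}.
Implicit Types a b d f n p q r s t x y z : M.

Definition subset x y : Prop := forall z, z ∈ x -> z ∈ y.
Definition upair a b : M := setof (fun x => x = a \/ x = b).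
Definition opair a b : M := upair (upair a a) (upair a b).

Definition is_fun f : Prop :=
  (forall z, z ∈ f -> exists a b, z = opair a b) /\
  (forall a b b', opair a b ∈ f -> opair a b' ∈ f -> b = b').
Definition dom f : M := setof (fun a => exists b, opair a b ∈ f).
Definition app f a : M := the (fun b => opair a b ∈ f).
Definition restrict f d : M :=
  setof (fun z => z ∈ f /\ exists a b, a ∈ d /\ z = opair a b).
(** The function with domain [d] and values [F a]. *)
Definition lam d (F : M -> M) : M :=
  setof (fun z => exists a, a ∈ d /\ z = opair a (F a)).

Definition transitive x : Prop := forall y, y ∈ x -> subset y x.
(** Under foundation, these are exactly the von Neumann ordinals. *)
Definition ordinal x : Prop :=
  transitive x /\ forall y, y ∈ x -> transitive y.

Definition succ x : M := setof (fun z => z ∈ x \/ z = x).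
Definition inductive x : Prop :=
  emptyset ∈ x /\ forall y, y ∈ x -> succ y ∈ x.
Definition omega : M := setof (fun n => forall x, inductive x -> n ∈ x).
Definition finite x : Prop :=
  exists n f, n ∈ omega /\ is_fun f /\ dom f = n /\
    (forall y, y ∈ x <-> exists i, i ∈ n /\ app f i = y) /\
    (forall i j, i ∈ n -> j ∈ n -> app f i = app f j -> i = j).

Definition trcl x : M :=
  setof (fun z => forall t, transitive t -> subset x t -> z ∈ t).
Definition V_omega : M := setof (fun x => finite (trcl x)).

(** [rec H a] is the value at [a] of the function [G] defined on the universe by
    ∈-recursion as [G x = H x (G ↾ x)]; as usual, it is read off from set-sized
    approximations. *)
Definition rec_approx (H : M -> M -> M) f t : Prop :=
  transitive t /\ is_fun f /\ dom f = t /\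
  forall x, x ∈ t -> app f x = H x (restrict f x).
Definition rec (H : M -> M -> M) a : M :=
  the (fun v => exists f t, rec_approx H f t /\ a ∈ t /\ v = app f a).

End Vocabulary.

(** * The Kripke model over a frame *)

Record frame (M : structure) : Type := Frame {
  nodes : M;
  le : M -> M -> Prop;
  bot : M
}.
Arguments nodes {M} _.
Arguments le {M} _ _ _.
Arguments bot {M} _.

Section Kripke.
Context {M : structure} (P : frame M).
Implicit Types a p q r x y : M.

Definition up p : M := setof (fun q => q ∈ nodes P /\ le P p q).

(** [tau r y] is the transition map into the node [r]; the source node [q] is
    determined by the domain of [y]. *)
Definition tau r y : M := restrict y (up r).

(** [x] is a function on [up p], with [x(q)] contained in the union over
    [β ∈ α] of the classes [W β q], and monotone. *)
Definition name_over (W : M -> M -> M) (alpha p x : M) : Prop :=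
  is_fun x /\ dom x = up p /\
  (forall q, q ∈ up p -> forall y, y ∈ app x q ->
     exists beta, beta ∈ alpha /\ y ∈ W beta q) /\
  (forall q r, q ∈ up p -> r ∈ up q -> forall y, y ∈ app x q ->
     tau r y ∈ app x r).

(** [V_stage alpha] is the function sending a node [p] to the [alpha]-th stage
    of names at [p], which is a set because the nodes form a set. *)
Definition V_stage (alpha : M) : M :=
  rec (fun a f => lam (nodes P) (fun p =>
    setof (name_over (fun b q => app (app f b) q) a p))) alpha.

Definition V_frame p x : Prop :=
  exists alpha, ordinal alpha /\ x ∈ app (V_stage alpha) p.

(** Forcing at [p]; the environment consists of elements of [V_frame p], and is
    transported along [tau] on passing to a later node. *)
Fixpoint forces (p : M) (A : form) (e : list M) : Prop :=
  match A with
  | Mem i j => val e i ∈ app (val e j) p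
  | Eq i j => forall q, q ∈ up p -> app (val e i) q = app (val e j) q
  | Fls => False
  | And B C => forces p B e /\ forces p C e
  | Or B C => forces p B e \/ forces p C e
  | Imp B C => forall q, q ∈ up p ->
      forces q B (map (tau q) e) -> forces q C (map (tau q) e)
  | All B => forall q, q ∈ up p -> forall x, V_frame q x ->
      forces q B (x :: map (tau q) e)
  | Ex B => exists x, V_frame p x /\ forces p B (x :: e)
  end.

Definition models (A : form) (e : list M) : Prop := forces (bot P) A e.

Definition check (a : M) : M :=
  rec (fun x f => lam (nodes P) (fun p =>
    setof (fun y => exists b, b ∈ x /\ y = tau p (app f b)))) a.

End Kripke.

(** * The frame of finite binary sequences *)

Definition two {M : structure} : M := succ (succ emptyset).

(** [s] is below [t] when [s] is an initial segment of [t]. *)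
Definition cantor_tree (M : structure) : frame M := {|
  nodes := setof (fun s => exists n, n ∈ omega /\ is_fun s /\ dom s = n /\
             forall i, i ∈ n -> app s i ∈ two);
  le := fun s t => s = restrict t (dom s);
  bot := emptyset
|}.

(** * The sentences *)

(** ∃x ∀y ¬∀z (¬¬ z ∈ x → z ∈ y), with z = 0, y = 1, x = 2 at the atoms. *)
Definition NDCom : form :=
  Ex (All (Neg (All (Imp (Neg (Neg (Mem 0 2))) (Mem 0 1))))).

(** ¬∃y ∀z (z ∈ y ↔ ¬¬ z ∈ x), where x is the free variable 0. *)
Definition no_double_complement : form :=
  Neg (Ex (All (Iff (Mem 0 1) (Neg (Neg (Mem 0 2)))))).

(* Main.v *)
From Stdlib Require Import List Arith Lia ClassicalEpsilon FunctionalExtensionality PropExtensionality.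
Require Import Defs.

(** A double complement of the canonical name of [V_omega], at a node [q], would be a name [y]
    containing, at every later node, all names that are densely equal to the canonical name of
    a hereditarily finite set.  There is a proper class of such names, of unbounded rank; rather
    than building them by transfinite recursion, the proof diagonalizes over [y] itself.

    Fix an infinite branch through [q], the spine: the extensions of [q] by zeros.  The nodes
    off the spine form a dense open set.  A name can therefore be prescribed off the spine, as
    the canonical name of some natural number at each off-spine node, and the result is densely
    in [V_omega] whatever it is on the spine.  On the spine it is given as many elements as
    possible: all members of [y] whose restrictions off the spine are members there
    ([closure]).  Everything so obtained is cut out of [y], hence it is a name of no higher
    stage than [y] ([V_frame_shrink]), and by assumption it belongs to [y].

    Call a member [u] of [y] at a spine node [unfounded] if it is maximal on the spine in this
    sense, and if the natural number which it equals off the spine grows beyond all bounds along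
    the spine.  The name that equals [k] where a node leaves the spine at position [k] is
    unfounded ([exists_unfounded]).  If [u] is unfounded, then let [w] be the closure of the
    assignment which has, off the spine, the predecessor of the number that [u] has.  Far
    enough up the spine that number is positive, so [w] is a member of [u] at every off-spine
    node there, and by maximality of [u] also at a spine node; moreover [w] is again unfounded
    ([unfounded_descends]).  Membership at a node lowers the set-theoretic rank, which
    contradicts foundation ([spine_contradiction]).

    The structure [M] is an arbitrary first-order model of ZFC, so each instance of separation,
    replacement or induction requires its predicate to be definable in [M].  The predicate [Def]
    and the tactic [dfn] provide this by closure under logical and set-theoretic operations.
    The operator [app] has a definable graph only on functions; it is therefore traded for the
    total operation [ap], and the recursion theorem ([rec_eq]) is proved for step functions
    that agree with a definable one on the arguments that occur in the recursion. *)

(** * Definability with parameters *)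

Section Definability.
Context {M : structure}.
Implicit Types (A B : form) (Q : (nat -> M) -> Prop).

(** Satisfaction under assignments to all variables at once: renaming then is composition, which
    finite lists with default values do not offer. *)
Fixpoint holds A (rho : nat -> M) : Prop :=
  match A with
  | Mem i j => rho i ∈ rho j
  | Eq i j => rho i = rho j
  | Fls => False
  | And B C => holds B rho /\ holds C rho
  | Or B C => holds B rho \/ holds C rho
  | Imp B C => holds B rho -> holds C rho
  | All B => forall x, holds B (fun i => match i with 0 => x | S j => rho j end)
  | Ex B => exists x, holds B (fun i => match i with 0 => x | S j => rho j end)
  end.

Lemma sat_holds A : forall e : list M, sat A e <-> holds A (val e).
Proof.
  assert (cons_val : forall (x : M) e,
    val (x :: e) = fun i => match i with 0 => x | S j => val e j end).
  { intros x e. extensionality i. now destruct i. }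
  induction A as [| | |B IHB C IHC|B IHB C IHC|B IHB C IHC|B IHB|B IHB];
    intro e; simpl; try reflexivity;
    try (rewrite IHB, IHC; reflexivity).
  - split; intros h x; specialize (h x); [rewrite IHB, cons_val in h | rewrite IHB, cons_val];
      exact h.
  - split; intros [x h]; exists x; [rewrite IHB, cons_val in h | rewrite IHB, cons_val]; exact h.
Qed.

Definition upren (f : nat -> nat) (i : nat) : nat :=
  match i with 0 => 0 | S j => S (f j) end.

Fixpoint rename (f : nat -> nat) A : form :=
  match A with
  | Mem i j => Mem (f i) (f j)
  | Eq i j => Eq (f i) (f j)
  | Fls => Fls
  | And B C => And (rename f B) (rename f C)
  | Or B C => Or (rename f B) (rename f C)
  | Imp B C => Imp (rename f B) (rename f C)
  | All B => All (rename (upren f) B)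
  | Ex B => Ex (rename (upren f) B)
  end.

Lemma holds_rename A : forall f rho,
  holds (rename f A) rho <-> holds A (fun i => rho (f i)).
Proof.
  assert (under : forall f rho (x : M),
    (fun i => match upren f i with 0 => x | S j => rho j end) =
    (fun i => match i with 0 => x | S j => rho (f j) end)).
  { intros f rho x. extensionality i. now destruct i. }
  induction A as [| | |B IHB C IHC|B IHB C IHC|B IHB C IHC|B IHB|B IHB];
    intros f rho; simpl; try reflexivity;
    try (rewrite IHB, IHC; reflexivity).
  - split; intros h x; specialize (h x); rewrite IHB, under in *; exact h.
  - split; intros [x h]; exists x; rewrite IHB, under in *; exact h.
Qed.

(** This leads back from assignments to the finite lists of parameters that occur in the axiom
    schemas. *)
Lemma holds_finite A : exists n, forall rho rho' : nat -> M,
  (forall i, i < n -> rho i = rho' i) -> holds A rho <-> holds A rho'.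
Proof.
  assert (both : forall B C,
    (exists n, forall rho rho' : nat -> M,
      (forall i, i < n -> rho i = rho' i) -> holds B rho <-> holds B rho') ->
    (exists n, forall rho rho' : nat -> M,
      (forall i, i < n -> rho i = rho' i) -> holds C rho <-> holds C rho') ->
    exists n, forall rho rho' : nat -> M,
      (forall i, i < n -> rho i = rho' i) ->
      (holds B rho <-> holds B rho') /\ (holds C rho <-> holds C rho')).
  { intros B C [n hn] [m hm]. exists (n + m). intros rho rho' h.
    split; [apply hn | apply hm]; intros i hi; apply h; lia. }
  induction A as [i j|i j| |B IHB C IHC|B IHB C IHC|B IHB C IHC|B [n hn]|B [n hn]].
  - exists (S (i + j)). intros rho rho' h. simpl. rewrite !h by lia. reflexivity.
  - exists (S (i + j)). intros rho rho' h. simpl. rewrite !h by lia. reflexivity.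
  - exists 0. reflexivity.
  - destruct (both B C IHB IHC) as [n hn]. exists n. intros rho rho' h.
    specialize (hn rho rho' h). simpl. tauto.
  - destruct (both B C IHB IHC) as [n hn]. exists n. intros rho rho' h.
    specialize (hn rho rho' h). simpl. tauto.
  - destruct (both B C IHB IHC) as [n hn]. exists n. intros rho rho' h.
    specialize (hn rho rho' h). simpl. tauto.
  - exists n. intros rho rho' h. simpl.
    split; intros k x; specialize (k x); revert k; apply hn;
      intros [|i] hi; auto; [symmetry|]; apply h; lia.
  - exists n. intros rho rho' h. simpl.
    split; intros [x k]; exists x; revert k; apply hn;
      intros [|i] hi; auto; [symmetry|]; apply h; lia.
Qed.

Definition instantiate (s : nat -> nat + M) (rho : nat -> M) (i : nat) : M :=
  match s i with inl j => rho j | inr c => c end.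

(** Each free variable of the formula is either read from the assignment or a parameter.  In this
    form closure properties do not mention lists of parameters. *)
Definition Def Q : Prop :=
  exists A s, forall rho, holds A (instantiate s rho) <-> Q rho.

Lemma Def_iff Q Q' : Def Q -> (forall rho, Q rho <-> Q' rho) -> Def Q'.
Proof.
  intros (A & s & h) e. exists A, s. intro rho. now rewrite h.
Qed.

(** Variables of the two formulas are kept apart as even and odd numbers, so that one instantiation
    serves both. *)
Lemma Def_merge Q Q' : Def Q -> Def Q' -> exists A B s, forall rho,
  (holds A (instantiate s rho) <-> Q rho) /\ (holds B (instantiate s rho) <-> Q' rho).
Proof.
  intros (A & s & hA) (B & t & hB).
  exists (rename (fun i => 2 * i) A), (rename (fun i => S (2 * i)) B),
    (fun i => if Nat.even i then s (Nat.div2 i) else t (Nat.div2 i)).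
  intro rho. rewrite !holds_rename, <- hA, <- hB. unfold instantiate.
  split; match goal with
    |- holds _ ?u <-> holds _ ?v => replace u with v; [reflexivity|] end;
    extensionality i.
  - rewrite Nat.even_mul, Nat.div2_double. reflexivity.
  - rewrite Nat.even_succ, <- Nat.negb_even, Nat.even_mul, Nat.div2_succ_double.
    reflexivity.
Qed.

Lemma Def_and Q Q' : Def Q -> Def Q' -> Def (fun rho => Q rho /\ Q' rho).
Proof.
  intros h h'. destruct (Def_merge _ _ h h') as (A & B & s & H).
  exists (And A B), s. intro rho. destruct (H rho). simpl. tauto.
Qed.
Lemma Def_or Q Q' : Def Q -> Def Q' -> Def (fun rho => Q rho \/ Q' rho).
Proof.
  intros h h'. destruct (Def_merge _ _ h h') as (A & B & s & H).
  exists (Or A B), s. intro rho. destruct (H rho). simpl. tauto.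
Qed.
Lemma Def_imp Q Q' : Def Q -> Def Q' -> Def (fun rho => Q rho -> Q' rho).
Proof.
  intros h h'. destruct (Def_merge _ _ h h') as (A & B & s & H).
  exists (Imp A B), s. intro rho. destruct (H rho). simpl. tauto.
Qed.
(** The proposition does not depend on the assignment; classically it is true or false. *)
Lemma Def_prop (p : Prop) : Def (fun _ => p).
Proof.
  destruct (classic p) as [h|h];
    [exists (Imp Fls Fls) | exists Fls]; exists inl; simpl; tauto.
Qed.
Lemma Def_not Q : Def Q -> Def (fun rho => ~ Q rho).
Proof. intro h. apply (Def_imp Q (fun _ => False)); [exact h | apply Def_prop]. Qed.
Lemma Def_equiv Q Q' : Def Q -> Def Q' -> Def (fun rho => Q rho <-> Q' rho).
Proof. intros h h'. apply Def_and; apply Def_imp; assumption. Qed.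

(** The variables that read position [0] of the assignment become the bound variable. *)
Lemma holds_bind A (s : nat -> nat + M) rho (x : M) :
  holds A (instantiate s (fun i => match i with 0 => x | S j => rho j end)) <->
  holds (rename (fun i => match s i with inl 0 => 0 | _ => S i end) A)
    (fun i => match i with 0 => x | S j => instantiate
      (fun i => match s i with inl (S j) => inl j | o => o end) rho j end).
Proof.
  rewrite holds_rename.
  match goal with |- holds _ ?u <-> holds _ ?v => replace u with v; [reflexivity|] end.
  extensionality i. unfold instantiate.
  destruct (s i) as [[|j]|c] eqn:e; rewrite ?e; reflexivity.
Qed.

Lemma Def_ex (P : (nat -> M) -> M -> Prop) :
  Def (fun rho => P (fun i => rho (S i)) (rho 0)) -> Def (fun rho => exists x, P rho x).
Proof.
  intros (A & s & h).
  eexists (Ex _), _. intro rho. simpl. split.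
  - intros [x k]. exists x. apply (proj2 (holds_bind A s rho x)) in k.
    apply h in k. exact k.
  - intros [x k]. exists x. apply (proj1 (holds_bind A s rho x)). now apply h.
Qed.
Lemma Def_all (P : (nat -> M) -> M -> Prop) :
  Def (fun rho => P (fun i => rho (S i)) (rho 0)) -> Def (fun rho => forall x, P rho x).
Proof.
  intros (A & s & h).
  eexists (All _), _. intro rho. simpl. split.
  - intros k x. specialize (k x). apply (proj2 (holds_bind A s rho x)) in k.
    apply h in k. exact k.
  - intros k x. apply (proj1 (holds_bind A s rho x)). now apply h.
Qed.

Lemma Def_subst Q (s : nat -> nat + M) : Def Q -> Def (fun rho => Q (instantiate s rho)).
Proof.
  intros (A & t & h).
  exists A, (fun i => match t i with inl j => s j | inr c => inr c end).
  intro rho. rewrite <- h.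
  match goal with |- holds _ ?u <-> holds _ ?v => replace u with v; [reflexivity|] end.
  extensionality i. unfold instantiate. destruct (t i); reflexivity.
Qed.

Definition DefT (t : (nat -> M) -> M) : Prop :=
  Def (fun rho => rho 0 = t (fun i => rho (S i))).

Lemma Def_eq_var i j : Def (fun rho => rho i = rho j).
Proof. exists (Eq i j), inl. reflexivity. Qed.
Lemma Def_mem_var i j : Def (fun rho => rho i ∈ rho j).
Proof. exists (Mem i j), inl. reflexivity. Qed.

Lemma DefT_var i : DefT (fun rho => rho i).
Proof. apply (Def_eq_var 0 (S i)). Qed.
Lemma DefT_const c : DefT (fun _ => c).
Proof.
  exists (Eq 0 1), (fun i => match i with 0 => inl 0 | _ => inr c end). reflexivity.
Qed.

(** The value [t rho] can be named by a quantifier, because its graph is definable. *)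
Lemma Def_let (P : (nat -> M) -> M -> Prop) t :
  DefT t -> Def (fun rho => P (fun i => rho (S i)) (rho 0)) -> Def (fun rho => P rho (t rho)).
Proof.
  intros ht hP. eapply Def_iff.
  - apply (Def_ex (fun rho x => x = t rho /\ P rho x)). apply Def_and; [exact ht | exact hP].
  - intro rho. split; [intros (x & -> & h); exact h | intro h; exists (t rho); auto].
Qed.

Lemma Def_subst2 (P : M -> M -> Prop) t u :
  Def (fun rho => P (rho 0) (rho 1)) -> DefT t -> DefT u -> Def (fun rho => P (t rho) (u rho)).
Proof.
  intros hP ht hu.
  apply (Def_let (fun rho x => P x (u rho)) t ht).
  assert (hu' : DefT (fun rho => u (fun i => rho (S i)))).
  { apply (Def_subst _ (fun i => match i with 0 => inl 0 | S j => inl (S (S j)) end)) in hu.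
    exact hu. }
  apply (Def_let (fun rho y => P (rho 0) y) _ hu').
  apply (Def_subst _ (fun i => match i with 0 => inl 1 | _ => inl 0 end)) in hP. exact hP.
Qed.

Lemma DefT_subst2 (F : M -> M -> M) t u :
  DefT (fun rho => F (rho 0) (rho 1)) -> DefT t -> DefT u -> DefT (fun rho => F (t rho) (u rho)).
Proof.
  intros hF ht hu. unfold DefT.
  assert (weaken : forall v, DefT v -> DefT (fun rho => v (fun i => rho (S i)))).
  { intros v hv.
    apply (Def_subst _ (fun i => match i with 0 => inl 0 | S j => inl (S (S j)) end)) in hv.
    exact hv. }
  apply (Def_let (fun rho x => rho 0 = F x (u (fun i => rho (S i))))
    (fun rho => t (fun i => rho (S i)))); [apply weaken, ht|].
  apply (Def_let (fun rho y => rho 1 = F (rho 0) y)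
    (fun rho => u (fun i => rho (S (S i))))); [exact (weaken _ (weaken _ hu))|].
  apply (Def_subst _ (fun i => match i with 0 => inl 2 | 1 => inl 1 | _ => inl 0 end)) in hF.
  exact hF.
Qed.

Lemma Def_mem t u : DefT t -> DefT u -> Def (fun rho => t rho ∈ u rho).
Proof. apply Def_subst2, Def_mem_var. Qed.
Lemma Def_eq t u : DefT t -> DefT u -> Def (fun rho => t rho = u rho).
Proof. apply (Def_subst2 eq), Def_eq_var. Qed.
End Definability.

Lemma Def_subst1 {M : structure} (P : M -> Prop) t :
  Def (fun rho => P (rho 0)) -> DefT t -> Def (fun rho => P (t rho)).
Proof. intros hP ht. apply (Def_subst2 (fun x _ => P x) t t hP ht ht). Qed.
Lemma DefT_subst1 {M : structure} (F : M -> M) t :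
  DefT (fun rho => F (rho 0)) -> DefT t -> DefT (fun rho => F (t rho)).
Proof. intros hF ht. apply (DefT_subst2 (fun x _ => F x) t t hF ht ht). Qed.

(** Definability of an expression is derived along its syntax: one closure lemma for each
    connective, quantifier and operation, and hypotheses for variable functions and predicates. *)
Create HintDb dfn discriminated.
#[export] Hint Resolve Def_and Def_or Def_imp Def_not Def_equiv Def_ex Def_all Def_mem Def_eq
  DefT_var DefT_const Def_prop : dfn.
#[export] Hint Extern 0 (Def _) => progress cbv beta : dfn.
#[export] Hint Extern 0 (DefT _) => progress cbv beta : dfn.
#[export] Hint Extern 1 (DefT (fun rho => ?F _)) =>
  match goal with h : DefT (fun rho => F (rho 0)) |- _ => apply (DefT_subst1 F _ h) end : dfn.
#[export] Hint Extern 1 (DefT (fun rho => ?F _ _)) =>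
  match goal with h : DefT (fun rho => F (rho 0) (rho 1)) |- _ => apply (DefT_subst2 F _ _ h) end : dfn.
#[export] Hint Extern 1 (Def (fun rho => ?F _)) =>
  match goal with h : Def (fun rho => F (rho 0)) |- _ => apply (Def_subst1 F _ h) end : dfn.
#[export] Hint Extern 1 (Def (fun rho => ?F _ _)) =>
  match goal with h : Def (fun rho => F (rho 0) (rho 1)) |- _ => apply (Def_subst2 F _ _ h) end : dfn.
Ltac dfn := auto 200 with dfn.

(** * Separation and replacement for definable predicates *)
Lemma setof_ext {M : structure} (P Q : M -> Prop) : (forall x, P x <-> Q x) -> setof P = setof Q.
Proof.
  intro h. replace Q with P; [reflexivity|].
  extensionality x. apply propositional_extensionality, h.
Qed.

(** Here [P r] is the predicate with all variables but one fixed by [r]. *)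
Lemma Def_close2 {M : structure} (P : (nat -> M) -> M -> Prop) :
  Def (fun rho => P (fun i => rho (S i)) (rho 0)) -> forall r, Def (fun rho => P r (rho 0)).
Proof.
  intros h r.
  apply (Def_subst _ (fun i => match i with 0 => inl 0 | S j => inr (r j) end)) in h. exact h.
Qed.
Lemma DefT_close2 {M : structure} (F : (nat -> M) -> M -> M) :
  DefT (fun rho => F (fun i => rho (S i)) (rho 0)) -> forall r, DefT (fun rho => F r (rho 0)).
Proof.
  intros h r.
  apply (Def_subst _ (fun i => match i with 0 => inl 0 | 1 => inl 1 | S (S j) => inr (r j) end)) in h.
  exact h.
Qed.

Section Sets.
Context {M : structure} (zfc : ZFC M).

Lemma ext (x y : M) : (forall z, z ∈ x <-> z ∈ y) -> x = y.
Proof. apply (extensionality M zfc). Qed.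

Lemma the_eq (Q : M -> Prop) v : (forall w, Q w <-> w = v) -> the Q = v.
Proof.
  intro h. apply h. unfold the. apply epsilon_spec. exists v. now apply h.
Qed.

Lemma setof_eq (Q : M -> Prop) y : (forall x, x ∈ y <-> Q x) -> setof Q = y.
Proof.
  intro h. apply the_eq. intro w. split.
  - intro k. apply ext. intro z. now rewrite k, h.
  - intros ->. exact h.
Qed.

Lemma setof_spec (Q : M -> Prop) : (exists y, forall x, x ∈ y <-> Q x) ->
  forall x, x ∈ setof Q <-> Q x.
Proof. intros [y h] x. rewrite (setof_eq Q y h). apply h. Qed.

Lemma DefT_setof (Q : (nat -> M) -> M -> Prop) :
  (forall rho, exists y, forall x, x ∈ y <-> Q rho x) ->
  Def (fun rho => Q (fun i => rho (S i)) (rho 0)) -> DefT (fun rho => setof (Q rho)).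
Proof.
  intros h d. eapply Def_iff.
  - apply (Def_all (fun rho x => x ∈ rho 0 <-> Q (fun i => rho (S i)) x)).
    apply Def_equiv; [apply Def_mem_var|].
    apply (Def_subst _ (fun i => match i with 0 => inl 0 | S j => inl (S (S j)) end)) in d.
    exact d.
  - intro rho. cbv beta. split; intro k.
    + symmetry. now apply setof_eq.
    + intro x. rewrite k. now apply setof_spec.
Qed.

(** The formula of [P] may have infinitely many parameters assigned, but only the first [n] matter;
    these form the list that the axiom asks for. *)
Lemma separate (P : M -> Prop) (a : M) : Def (fun rho => P (rho 0)) ->
  exists b, forall x, x ∈ b <-> x ∈ a /\ P x.
Proof.
  intros (A & s & h). destruct (holds_finite (M:=M) A) as [n hn].
  destruct (nonempty M) as [d].
  set (c i := match s i with inr c => c | _ => d end).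
  destruct (separation M zfc
    (rename (fun i => match s i with inl 0 => 0 | _ => S i end) A)
    (map c (seq 0 n)) a) as [b hb].
  exists b. intro x. rewrite hb, sat_holds, holds_rename.
  rewrite <- (h (fun i => match i with 0 => x | _ => d end)).
  apply and_iff_compat_l. apply hn. intros i hi.
  assert (v : val (x :: map c (seq 0 n)) (S i) = c i).
  { unfold val. simpl. rewrite nth_indep with (d' := c 0) by (now rewrite length_map, length_seq).
    rewrite map_nth, seq_nth; auto. }
  unfold instantiate. destruct (s i) as [[|j]|e] eqn:E.
  - reflexivity.
  - rewrite v. unfold c. now rewrite E.
  - rewrite v. unfold c. now rewrite E.
Qed.

Lemma replace_rel (R : M -> M -> Prop) (a : M) : Def (fun rho => R (rho 0) (rho 1)) ->
  (forall x, x ∈ a -> exists! y, R x y) ->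
  exists b, forall y, y ∈ b <-> exists x, x ∈ a /\ R x y.
Proof.
  intros (A & s & h) u. destruct (holds_finite (M:=M) A) as [n hn].
  destruct (nonempty M) as [d].
  set (c i := match s i with inr c => c | _ => d end).
  set (B := rename (fun i => match s i with inl 0 => 0 | inl 1 => 1 | _ => S (S i) end) A).
  set (e := map c (seq 0 n)).
  assert (E : forall x y, sat B (x :: y :: e) <-> R x y).
  { intros x y. unfold B. rewrite sat_holds, holds_rename.
    rewrite <- (h (fun i => match i with 0 => x | 1 => y | _ => d end)).
    apply hn. intros i hi.
    assert (v : val (x :: y :: e) (S (S i)) = c i).
    { unfold val, e. simpl.
      rewrite nth_indep with (d' := c 0) by (now rewrite length_map, length_seq).
      rewrite map_nth, seq_nth; auto. }
    unfold instantiate. destruct (s i) as [[|[|j]]|k] eqn:E.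
    - reflexivity.
    - reflexivity.
    - rewrite v. unfold c. now rewrite E.
    - rewrite v. unfold c. now rewrite E. }
  destruct (replacement M zfc B e a) as [b hb].
  { intros x hx. destruct (u x hx) as (y & hy & uy). exists y. split.
    - now apply E.
    - intros y' k. apply uy. now apply E. }
  exists b. intro y. rewrite hb. split; intros (x & hx & k); exists x; split; auto; now apply E.
Qed.

Lemma replace_fun (F : M -> M) (a : M) : DefT (fun rho => F (rho 0)) ->
  exists b, forall y, y ∈ b <-> exists x, x ∈ a /\ y = F x.
Proof.
  intro d. apply (replace_rel (fun x y => y = F x)).
  - dfn.
  - intros x _. exists (F x). split; auto.
Qed.

(** * Set operations and their definability *)
Definition sub (a : M) (P : M -> Prop) : M := setof (fun x => x ∈ a /\ P x).
Definition image (a : M) (F : M -> M) : M := setof (fun y => exists x, x ∈ a /\ y = F x).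
Definition bigunion (a : M) : M := setof (fun z => exists y, y ∈ a /\ z ∈ y).
Definition pow (a : M) : M := setof (fun z => subset z a).
(** Where [f] has no single value at [a], [app f a] is an arbitrary element, so that [app] has no
    definable graph.  The operation [ap] is definable everywhere and agrees with [app] on
    functions. *)
Definition ap (f a : M) : M := setof (fun z => exists b, opair a b ∈ f /\ z ∈ b).

Lemma in_sub a P : Def (fun rho => P (rho 0)) -> forall x, x ∈ sub a P <-> x ∈ a /\ P x.
Proof. intro d. apply setof_spec. now apply separate. Qed.
Lemma DefT_sub a P : DefT a -> Def (fun rho => P (fun i => rho (S i)) (rho 0)) ->
  DefT (fun rho => sub (a rho) (P rho)).
Proof.
  intros ha hP. apply (DefT_setof (fun rho x => x ∈ a rho /\ P rho x)).
  - intro rho. apply separate. now apply Def_close2.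
  - apply Def_and; [|exact hP]. apply Def_mem; [apply DefT_var|].
    apply (Def_subst _ (fun i => match i with 0 => inl 0 | S j => inl (S (S j)) end)) in ha.
    exact ha.
Qed.

Lemma in_image a F : DefT (fun rho => F (rho 0)) ->
  forall y, y ∈ image a F <-> exists x, x ∈ a /\ y = F x.
Proof. intro d. apply setof_spec. now apply replace_fun. Qed.

Lemma exists_bounded (P : M -> Prop) (b : M) :
  (forall x, P x -> x ∈ b) -> Def (fun rho => P (rho 0)) -> exists y, forall x, x ∈ y <-> P x.
Proof.
  intros h d. destruct (separate P b d) as [y hy]. exists y. intro x. rewrite hy. firstorder.
Qed.

Lemma empty_ex : exists o : M, forall z, z ∈ o <-> False.
Proof.
  destruct (infinity M zfc) as (_ & (o & _ & h) & _). exists o. firstorder.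
Qed.
Lemma in_empty z : z ∈ (emptyset : M) <-> False.
Proof. apply (setof_spec (fun _ => False)), empty_ex. Qed.

Lemma in_upair a b x : x ∈ (upair a b : M) <-> x = a \/ x = b.
Proof. apply (setof_spec (fun x => x = a \/ x = b)), (pairing M zfc). Qed.
Lemma DefT_upair (a b : (nat -> M) -> M) :
  DefT a -> DefT b -> DefT (fun rho => upair (a rho) (b rho)).
Proof.
  apply (DefT_subst2 upair), (DefT_setof (fun rho x => x = rho 0 \/ x = rho 1)).
  - intro; apply (pairing M zfc).
  - dfn.
Qed.
Hint Resolve DefT_upair DefT_sub : dfn.
Lemma DefT_opair (a b : (nat -> M) -> M) :
  DefT a -> DefT b -> DefT (fun rho => opair (a rho) (b rho)).
Proof. apply (DefT_subst2 opair). unfold opair. dfn. Qed.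
Hint Resolve DefT_opair : dfn.

Lemma opair_inj (a b c d : M) : opair a b = opair c d -> a = c /\ b = d.
Proof.
  intro h.
  assert (k : forall z, z = upair a a \/ z = upair a b <-> z = upair c c \/ z = upair c d).
  { intro z. rewrite <- !in_upair. unfold opair in h. now rewrite h. }
  assert (e : forall a b c d : M, upair a b = upair c d ->
     forall x, x = a \/ x = b <-> x = c \/ x = d).
  { intros ? ? ? ? e x. now rewrite <- !in_upair, e. }
  assert (ac : a = c).
  { destruct (proj1 (k (upair a a)) (or_introl eq_refl)) as [w|w];
      pose proof (e _ _ _ _ w) as w'.
    - specialize (w' a). intuition.
    - destruct (w' c). intuition. }
  subst c. split; [reflexivity|].
  destruct (proj1 (k (upair a b)) (or_intror eq_refl)) as [w|w];
    pose proof (e _ _ _ _ w) as w'.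
  - destruct (proj2 (k (upair a d)) (or_intror eq_refl)) as [v|v];
      pose proof (e _ _ _ _ v) as v'; pose proof (w' b); pose proof (v' d);
      intuition congruence.
  - pose proof (w' b); pose proof (w' d); intuition congruence.
Qed.

Lemma in_bigunion (a : M) z : z ∈ bigunion a <-> exists y, y ∈ a /\ z ∈ y.
Proof. apply (setof_spec (fun z => exists y, y ∈ a /\ z ∈ y)), (union M zfc). Qed.
Lemma DefT_bigunion (a : (nat -> M) -> M) : DefT a -> DefT (fun rho => bigunion (a rho)).
Proof.
  apply (DefT_subst1 bigunion), (DefT_setof (fun rho z => exists y, y ∈ rho 0 /\ z ∈ y)).
  - intro. apply (union M zfc).
  - dfn.
Qed.
Lemma in_pow (a : M) z : z ∈ pow a <-> subset z a.
Proof. apply (setof_spec (fun z => subset z a)), (powerset M zfc). Qed.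
Lemma DefT_pow (a : (nat -> M) -> M) : DefT a -> DefT (fun rho => pow (a rho)).
Proof.
  apply (DefT_subst1 pow), (DefT_setof (fun rho z => subset z (rho 0))).
  - intro. apply (powerset M zfc).
  - unfold subset. dfn.
Qed.
Hint Resolve DefT_bigunion DefT_pow : dfn.

Lemma opair_bound (f a b : M) : opair a b ∈ f ->
  a ∈ bigunion (bigunion f) /\ b ∈ bigunion (bigunion f).
Proof.
  intro h. rewrite !in_bigunion.
  assert (k : upair a b ∈ bigunion f).
  { apply in_bigunion. exists (opair a b). split; [exact h|]. apply in_upair. now right. }
  split; exists (upair a b); split; auto; apply in_upair; auto.
Qed.

Lemma in_dom (f a : M) : a ∈ dom f <-> exists b, opair a b ∈ f.
Proof.
  apply (setof_spec (fun a => exists b, opair a b ∈ f)).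
  apply (exists_bounded _ (bigunion (bigunion f))).
  - intros x [b h]. now apply opair_bound in h.
  - dfn.
Qed.
Lemma DefT_dom (f : (nat -> M) -> M) : DefT f -> DefT (fun rho => dom (f rho)).
Proof.
  apply (DefT_subst1 dom), (DefT_setof (fun rho a => exists b, opair a b ∈ rho 0)).
  - intro rho. apply (exists_bounded _ (bigunion (bigunion (rho 0)))).
    + intros x [b h]. now apply opair_bound in h.
    + dfn.
  - dfn.
Qed.
Lemma in_ap (f a z : M) : z ∈ ap f a <-> exists b, opair a b ∈ f /\ z ∈ b.
Proof.
  apply (setof_spec (fun z => exists b, opair a b ∈ f /\ z ∈ b)).
  apply (exists_bounded _ (bigunion (bigunion (bigunion f)))).
  - intros x [b [h k]]. apply opair_bound in h. apply in_bigunion. exists b. tauto.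
  - dfn.
Qed.
Lemma DefT_ap (f a : (nat -> M) -> M) :
  DefT f -> DefT a -> DefT (fun rho => ap (f rho) (a rho)).
Proof.
  apply (DefT_subst2 ap), (DefT_setof (fun rho z => exists b, opair (rho 1) b ∈ rho 0 /\ z ∈ b)).
  - intro rho. exists (ap (rho 0) (rho 1)). apply in_ap.
  - dfn.
Qed.

Lemma in_restrict (f d z : M) :
  z ∈ restrict f d <-> z ∈ f /\ exists a b, a ∈ d /\ z = opair a b.
Proof.
  apply (setof_spec (fun z => z ∈ f /\ exists a b, a ∈ d /\ z = opair a b)).
  apply separate. dfn.
Qed.
Lemma DefT_restrict (f d : (nat -> M) -> M) :
  DefT f -> DefT d -> DefT (fun rho => restrict (f rho) (d rho)).
Proof.
  apply (DefT_subst2 restrict),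
    (DefT_setof (fun rho z => z ∈ rho 0 /\ exists a b, a ∈ rho 1 /\ z = opair a b)).
  - intro rho. exists (restrict (rho 0) (rho 1)). apply in_restrict.
  - dfn.
Qed.

Lemma in_lam (d : M) F : DefT (fun rho => F (rho 0)) ->
  forall z, z ∈ lam d F <-> exists a, a ∈ d /\ z = opair a (F a).
Proof.
  intros h z. apply (setof_spec (fun z => exists a, a ∈ d /\ z = opair a (F a))).
  apply (replace_fun (fun a => opair a (F a))). dfn.
Qed.
Lemma DefT_lam (d : (nat -> M) -> M) F : DefT d ->
  DefT (fun rho => F (fun i => rho (S i)) (rho 0)) -> DefT (fun rho => lam (d rho) (F rho)).
Proof.
  intros hd hF.
  apply (DefT_setof (fun rho z => exists a, a ∈ d rho /\ z = opair a (F rho a))).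
  - intro rho. apply (replace_fun (fun a => opair a (F rho a))).
    pose proof (DefT_close2 F hF rho). dfn.
  - apply (Def_ex (fun rho a => a ∈ d (fun i => rho (S i)) /\
      rho 0 = opair a (F (fun i => rho (S i)) a))).
    assert (DefT (fun rho => d (fun i => rho (S (S i))))).
    { apply (Def_subst _ (fun i => match i with 0 => inl 0 | S j => inl (S (S (S j))) end)) in hd.
      exact hd. }
    assert (DefT (fun rho => F (fun i => rho (S (S i))) (rho 0))).
    { apply (Def_subst _ (fun i => match i with 0 => inl 0 | 1 => inl 1
         | S (S j) => inl (S (S (S j))) end)) in hF.
      exact hF. }
    dfn.
Qed.
Hint Resolve DefT_dom DefT_ap DefT_restrict DefT_lam : dfn.

(** * Functions as sets of pairs *)
Lemma app_eq (f a b : M) : is_fun f -> opair a b ∈ f -> app f a = b.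
Proof.
  intros [_ h] k. apply the_eq. intro w. split.
  - intro k'. now apply (h a).
  - now intros ->.
Qed.
Lemma app_in (f a : M) : is_fun f -> a ∈ dom f -> opair a (app f a) ∈ f.
Proof.
  intros h k. apply in_dom in k. destruct k as [b k]. now rewrite (app_eq f a b).
Qed.
Lemma ap_app (f a : M) : is_fun f -> a ∈ dom f -> ap f a = app f a.
Proof.
  intros h k. apply ext. intro z. rewrite in_ap. split.
  - intros (b & hb & hz). now rewrite (app_eq f a b).
  - intro hz. exists (app f a). split; [now apply app_in | exact hz].
Qed.
Lemma fun_ext (f g : M) : is_fun f -> is_fun g -> dom f = dom g ->
  (forall a, a ∈ dom f -> app f a = app g a) -> f = g.
Proof.
  assert (half : forall f g : M, is_fun f -> is_fun g -> dom f = dom g ->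
    (forall a, a ∈ dom f -> app f a = app g a) -> forall z, z ∈ f -> z ∈ g).
  { intros f' g' hf hg d e z hz. destruct (proj1 hf z hz) as (a & b & ->).
    assert (k : a ∈ dom f') by (apply in_dom; eauto).
    rewrite <- (app_eq f' a b hf hz), (e a k). apply app_in; [exact hg|]. now rewrite <- d. }
  intros hf hg d e. apply ext. intro z. split; [now apply half|].
  apply half; auto. intros a ha. symmetry. apply e. now rewrite d.
Qed.

Section Lam.
Context (d : M) (F : M -> M) (hF : DefT (fun rho => F (rho 0))).
Lemma opair_lam a b : opair a b ∈ lam d F <-> a ∈ d /\ b = F a.
Proof.
  rewrite in_lam by exact hF. split.
  - intros (a' & h & e). apply opair_inj in e. destruct e; subst; auto.
  - intros [h ->]. eauto.
Qed.
Lemma is_fun_lam : is_fun (lam d F).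
Proof.
  split.
  - intros z hz. apply in_lam in hz; [|exact hF]. destruct hz as (a & _ & ->). eauto.
  - intros a b b'. rewrite !opair_lam. intuition congruence.
Qed.
Lemma dom_lam : dom (lam d F) = d.
Proof.
  apply ext. intro a. rewrite in_dom. split.
  - intros [b h]. now apply opair_lam in h.
  - intro h. exists (F a). now apply opair_lam.
Qed.
Lemma app_lam a : a ∈ d -> app (lam d F) a = F a.
Proof. intro h. apply app_eq; [apply is_fun_lam | now apply opair_lam]. Qed.
End Lam.

Lemma lam_congr (d : M) F G : (forall a, a ∈ d -> F a = G a) -> lam d F = lam d G.
Proof.
  intro h. apply setof_ext. intro z. split; intros (a & ha & ->); exists a; split; auto;
    now rewrite h.
Qed.

Lemma opair_restrict (f d a b : M) : opair a b ∈ restrict f d <-> opair a b ∈ f /\ a ∈ d.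
Proof.
  rewrite in_restrict. split.
  - intros [h (a' & b' & k & e)]. apply opair_inj in e. destruct e; subst; auto.
  - intros [h k]. eauto.
Qed.
Lemma is_fun_restrict (f d : M) : is_fun f -> is_fun (restrict f d).
Proof.
  intros [h k]. split.
  - intros z hz. apply in_restrict in hz. apply h, hz.
  - intros a b b'. rewrite !opair_restrict. intros [] []. now apply (k a).
Qed.
Lemma in_dom_restrict (f d a : M) : a ∈ dom (restrict f d) <-> a ∈ dom f /\ a ∈ d.
Proof.
  rewrite !in_dom. setoid_rewrite opair_restrict. firstorder.
Qed.
Lemma dom_restrict (f d : M) : subset d (dom f) -> dom (restrict f d) = d.
Proof.
  intro h. apply ext. intro a. rewrite in_dom_restrict.
  split; [now intros []|]. intro k. split; [now apply h | exact k].
Qed.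
Lemma app_restrict (f d a : M) : is_fun f -> a ∈ dom f -> a ∈ d -> app (restrict f d) a = app f a.
Proof.
  intros hf ha hd. apply app_eq; [now apply is_fun_restrict|].
  apply opair_restrict. split; [now apply app_in | exact hd].
Qed.

(** * Recursion on a transitive set *)
Section Approx.
Context (H : M -> M -> M) (hH : DefT (fun rho => H (rho 0) (rho 1))).

Lemma rec_approx_ap f t x : rec_approx H f t -> x ∈ t -> ap f x = app f x.
Proof. intros (_ & ff & df & _) hx. apply ap_app; congruence. Qed.
(** Foundation, applied to the set of points of disagreement, suffices.  Induction over the universe
    is not available yet: it rests on transitive closures, which are obtained by recursion. *)
Lemma rec_approx_unique f t f' t' : rec_approx H f t -> rec_approx H f' t' ->
  forall x, x ∈ t -> x ∈ t' -> app f x = app f' x.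
Proof.
  intros (tt & ff & df & ef) (tt' & ff' & df' & ef') x hx hx'.
  apply NNPP. intro ne.
  destruct (foundation M zfc (sub t (fun x => x ∈ t' /\ ap f x <> ap f' x))) as (y & hy & my).
  { exists x. apply in_sub; [dfn|]. rewrite !ap_app by congruence. auto. }
  apply in_sub in hy; [|dfn]. destruct hy as (yt & yt' & ne'). apply ne'.
  rewrite !ap_app, ef, ef' by congruence. f_equal.
  assert (s : subset y (dom f)) by (rewrite df; now apply tt).
  assert (s' : subset y (dom f')) by (rewrite df'; now apply tt').
  apply fun_ext; auto using is_fun_restrict; rewrite !dom_restrict; auto.
  intros a ha. rewrite !app_restrict; auto.
  apply NNPP. intro na. apply (my a ha). apply in_sub; [dfn|].
  rewrite !ap_app; auto. repeat split; auto; [rewrite <- df | rewrite <- df']; auto.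
Qed.

Lemma Def_rec_approx (f t : (nat -> M) -> M) :
  DefT f -> DefT t -> Def (fun rho => rec_approx H (f rho) (t rho)).
Proof.
  apply (Def_subst2 (rec_approx H)).
  apply (Def_iff (fun rho => transitive (rho 1) /\ is_fun (rho 0) /\ dom (rho 0) = rho 1 /\
    forall x, x ∈ rho 1 -> ap (rho 0) x = H x (restrict (rho 0) x))).
  - unfold transitive, is_fun, subset. dfn.
  - intro rho. split; intros (tt & ff & df & e); repeat split; try apply tt; try apply ff; auto;
      intros x hx; specialize (e x hx); rewrite ?ap_app in * by congruence; auto.
Qed.
Hint Resolve Def_rec_approx : dfn.

(** One more value can be added at a point all of whose elements are already covered. *)
Lemma rec_approx_extend g t x : rec_approx H g t -> subset x t -> ~ x ∈ t ->
  exists g' t', rec_approx H g' t' /\ x ∈ t'.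
Proof.
  intros (tt & ff & df & e) sx nx.
  destruct (pairing M zfc x x) as [p hp].
  set (v := H x (restrict g x)).
  set (t' := bigunion (upair t p)).
  assert (ht' : forall z, z ∈ t' <-> z ∈ t \/ z = x).
  { intro z. unfold t'. rewrite in_bigunion. split.
    - intros (y & hy & hz). apply in_upair in hy. destruct hy; subst; auto.
      apply hp in hz. intuition.
    - intros [hz| ->]; [exists t | exists p]; rewrite in_upair, ?hp; auto. }
  set (g' := bigunion (upair g (upair (opair x v) (opair x v)))).
  assert (hg' : forall z, z ∈ g' <-> z ∈ g \/ z = opair x v).
  { intro z. unfold g'. rewrite in_bigunion. split.
    - intros (y & hy & hz). apply in_upair in hy. destruct hy; subst; auto.
      apply in_upair in hz. intuition.
    - intros [hz| ->]; [exists g | eexists]; rewrite in_upair; split; auto.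
      apply in_upair. auto. }
  assert (fg' : is_fun g').
  { split.
    - intros z hz. apply hg' in hz. destruct hz as [hz| ->]; [now apply ff | eauto].
    - intros a b b'. rewrite !hg'. intros [h|h] [h'|h'].
      + now apply (proj2 ff a).
      + apply opair_inj in h'. destruct h' as [-> _]. destruct nx. rewrite <- df.
        apply in_dom. eauto.
      + apply opair_inj in h. destruct h as [-> _]. destruct nx. rewrite <- df.
        apply in_dom. eauto.
      + apply opair_inj in h, h'. destruct h, h'. congruence. }
  assert (dg' : dom g' = t').
  { apply ext. intro a. rewrite in_dom, ht', <- df, in_dom. split.
    - intros [b h]. apply hg' in h. destruct h as [h|h]; [eauto|].
      apply opair_inj in h. now right.
    - intros [[b h]| ->]; [exists b | exists v]; apply hg'; auto. }
  assert (res : forall y, subset y t -> restrict g' y = restrict g y).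
  { intros y hy. apply ext. intro z. rewrite !in_restrict, hg'. split; intros [h k].
    - split; [|exact k]. destruct h as [h| ->]; [exact h|]. destruct k as (a & b & ha & k).
      apply opair_inj in k. destruct k as [<- _]. now destruct nx; apply hy.
    - auto. }
  exists g', t'. split; [|apply ht'; auto]. repeat split; auto; try apply fg'.
  - intros y hy z hz. apply ht' in hy. apply ht'. left.
    destruct hy as [hy| ->]; [now apply (tt y) | now apply sx].
  - intros y hy. apply ht' in hy. destruct hy as [hy| ->].
    + rewrite res by now apply tt. rewrite <- e by exact hy.
      apply app_eq; [exact fg'|]. apply hg'. left. apply app_in; congruence.
    + rewrite res by exact sx.
      apply app_eq; [exact fg'|]. apply hg'. now right.
Qed.

(** The covered elements of [t] form a transitive set, on which all approximations glue together by
    uniqueness.  If they did not exhaust [t], then the glued approximation could be extended at an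
    ∈-minimal missing element. *)
Lemma rec_approx_covers t : transitive t ->
  forall x, x ∈ t -> exists f t', rec_approx H f t' /\ x ∈ t'.
Proof.
  intros tt.
  set (good x := exists f t', rec_approx H f t' /\ x ∈ t').
  assert (dgood : Def (fun rho => good (rho 0))) by (unfold good; dfn).
  set (t0 := sub t good).
  assert (tt0 : transitive t0).
  { intros y hy z hz. apply in_sub in hy; [|exact dgood]. destruct hy as (hy & f & t' & hf & k).
    apply in_sub; [exact dgood|]. split; [now apply (tt y)|].
    exists f, t'. split; [exact hf|]. apply (proj1 hf y k z hz). }
  destruct (replace_rel
    (fun b z => exists f t', rec_approx H f t' /\ b ∈ t' /\ z = opair b (ap f b)) t0)
    as [g hg]; [dfn| |].
  { intros b hb. apply in_sub in hb; [|exact dgood]. destruct hb as (_ & f & t' & hf & k).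
    exists (opair b (ap f b)). split; [now exists f, t'|].
    intros z (f' & t'' & hf' & k' & ->). f_equal.
    rewrite (rec_approx_ap f' t''), (rec_approx_ap f t') by assumption.
    now apply (rec_approx_unique _ t' _ t''). }
  assert (hg' : forall b v, opair b v ∈ g <-> b ∈ t0 /\
    exists f t', rec_approx H f t' /\ b ∈ t' /\ v = app f b).
  { intros b v. rewrite hg. split.
    - intros (b' & hb & f & t' & hf & k & e). apply opair_inj in e. destruct e as [-> ->].
      split; [exact hb|]. exists f, t'. repeat (split; [assumption|]).
      now apply (rec_approx_ap f t').
    - intros (hb & f & t' & hf & k & ->). exists b. split; [exact hb|]. exists f, t'.
      repeat (split; [assumption|]). f_equal. symmetry.
      now apply (rec_approx_ap f t'). }
  assert (fg : is_fun g).
  { split.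
    - intros z hz. apply hg in hz. destruct hz as (b & _ & f & _ & _ & _ & ->). eauto.
    - intros a b b'. rewrite !hg'. intros (_ & f & u & hf & k & ->) (_ & f' & u' & hf' & k' & ->).
      now apply (rec_approx_unique _ u _ u'). }
  assert (val_g : forall x f t', rec_approx H f t' -> x ∈ t' -> x ∈ t0 -> app g x = app f x).
  { intros x f t' hf k hx. apply app_eq; [exact fg|]. apply hg'. eauto 6. }
  assert (dg : dom g = t0).
  { apply ext. intro b. rewrite in_dom. split.
    - intros [v hv]. now apply hg' in hv.
    - intro hb. pose proof hb as k. apply in_sub in k; [|exact dgood].
      destruct k as (_ & f & t' & hf & k). exists (app f b). apply hg'. eauto 6. }
  assert (ag : rec_approx H g t0).
  { repeat split; try apply fg; auto. intros x hx.
    pose proof hx as k. apply in_sub in k; [|exact dgood].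
    destruct k as (_ & f & t' & hf & k). rewrite (val_g x f t') by auto.
    destruct hf as (tt' & ff & df & ef). rewrite ef by exact k. f_equal.
    assert (s : subset x (dom g)) by (rewrite dg; now apply tt0).
    assert (s' : subset x (dom f)) by (rewrite df; now apply tt').
    apply fun_ext; auto using is_fun_restrict; rewrite !dom_restrict; auto.
    intros a ha. rewrite !app_restrict; auto. symmetry. apply (val_g a f t').
    - exact (conj tt' (conj ff (conj df ef))).
    - rewrite <- df. now apply s'.
    - rewrite <- dg. now apply s. }
  intros x hx. apply NNPP. intro nx.
  destruct (foundation M zfc (sub t (fun x => ~ good x))) as (y & hy & my).
  { exists x. apply in_sub; [dfn|]. now split. }
  apply in_sub in hy; [|dfn]. destruct hy as [yt ny]. apply ny.
  apply (rec_approx_extend g t0 y ag).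
  - intros z hz. apply in_sub; [exact dgood|]. split; [now apply (tt y)|].
    apply NNPP. intro nz. apply (my z hz). apply in_sub; [dfn|]. split; [now apply (tt y) | exact nz].
  - intro k. apply in_sub in k; [|exact dgood]. apply ny, k.
Qed.
End Approx.

(** * Natural numbers, transitive closures and induction *)
Lemma in_succ (x z : M) : z ∈ succ x <-> z ∈ x \/ z = x.
Proof.
  apply (setof_spec (fun z => z ∈ x \/ z = x)).
  exists (bigunion (upair x (upair x x))). intro w. rewrite in_bigunion. split.
  - intros (y & hy & hw). apply in_upair in hy. destruct hy; subst; auto.
    apply in_upair in hw. tauto.
  - intros [h| ->]; [exists x | exists (upair x x)]; rewrite !in_upair; auto.
Qed.
Lemma DefT_succ (x : (nat -> M) -> M) : DefT x -> DefT (fun rho => succ (x rho)).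
Proof.
  apply (DefT_subst1 succ), (DefT_setof (fun rho z => z ∈ rho 0 \/ z = rho 0)).
  - intro rho. exists (succ (rho 0)). apply in_succ.
  - dfn.
Qed.
Hint Resolve DefT_succ : dfn.

Lemma in_omega (n : M) : n ∈ omega <-> forall x : M, inductive x -> n ∈ x.
Proof.
  apply (setof_spec (fun n => forall x : M, inductive x -> n ∈ x)).
  destruct (infinity M zfc) as (w & (o & ho & eo) & hw).
  apply (exists_bounded _ w).
  - intros x hx. apply hx. split.
    + replace emptyset with o; [exact ho|]. apply ext. intro z. rewrite in_empty. firstorder.
    + intros y hy. destruct (hw y hy) as (s & hs & es).
      replace (succ y) with s; [exact hs|]. apply ext. intro z. now rewrite es, in_succ.
  - unfold inductive. dfn.
Qed.
Lemma zero_omega : emptyset ∈ (omega : M).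
Proof. apply in_omega. intros x h. apply h. Qed.
Lemma succ_omega (n : M) : n ∈ omega -> succ n ∈ omega.
Proof. rewrite !in_omega. intros h x hx. apply hx, h, hx. Qed.
Lemma omega_ind (P : M -> Prop) : Def (fun rho => P (rho 0)) ->
  P emptyset -> (forall n, n ∈ omega -> P n -> P (succ n)) -> forall n, n ∈ omega -> P n.
Proof.
  intros d h0 hs n hn.
  assert (k : n ∈ sub omega P).
  { apply (proj1 (in_omega n) hn). split; [|intros y hy];
      rewrite in_sub in * by exact d; auto using zero_omega.
    split; [now apply succ_omega | now apply hs]. }
  now apply in_sub in k.
Qed.

Lemma omega_transitive : transitive (omega : M).
Proof.
  intros n hn. revert n hn. apply omega_ind.
  - unfold subset. dfn.
  - intros z hz. now apply in_empty in hz.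
  - intros n hn h z hz. apply in_succ in hz. destruct hz as [hz| ->]; auto.
Qed.
Lemma nat_transitive (n : M) : n ∈ omega -> transitive n.
Proof.
  revert n. apply omega_ind.
  - unfold transitive, subset. dfn.
  - intros z hz. now apply in_empty in hz.
  - intros n hn h z hz w hw. apply in_succ in hz. apply in_succ. left.
    destruct hz as [hz| ->]; [now apply (h z) | exact hw].
Qed.
Lemma mem_irrefl (x : M) : ~ x ∈ x.
Proof.
  intro h. destruct (foundation M zfc (upair x x)) as (y & hy & k).
  - exists x. apply in_upair. auto.
  - apply in_upair in hy. assert (y = x) by tauto. subst y.
    apply (k x h), in_upair. auto.
Qed.
Lemma succ_mem (m n : M) : n ∈ omega -> m ∈ n -> succ m ∈ succ n.
Proof.
  intro hn. revert m. revert n hn.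
  apply (omega_ind (fun n => forall m, m ∈ n -> succ m ∈ succ n)); [dfn| |].
  - intros m hm. now apply in_empty in hm.
  - intros n hn h m hm. apply in_succ in hm. apply in_succ.
    destruct hm as [hm| ->]; [left; auto | now right].
Qed.
Lemma zero_mem_succ (n : M) : n ∈ omega -> emptyset ∈ succ n.
Proof.
  revert n. apply omega_ind; [dfn| |].
  - apply in_succ. now right.
  - intros n _ h. apply in_succ. now left.
Qed.
Lemma nat_total (m n : M) : m ∈ omega -> n ∈ omega -> m ∈ n \/ m = n \/ n ∈ m.
Proof.
  intros hm hn. revert m hm n hn.
  apply (omega_ind (fun m => forall n, n ∈ omega -> m ∈ n \/ m = n \/ n ∈ m)); [dfn| |].
  - apply omega_ind; [dfn|auto|]. intros n hn _. left. now apply zero_mem_succ.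
  - intros m hm h n hn. destruct (h n hn) as [k|[<-|k]].
    + pose proof (succ_mem m n hn k) as k'. apply in_succ in k'. tauto.
    + right. right. apply in_succ. auto.
    + right. right. apply in_succ. auto.
Qed.
(** Recursion on the transitive set [omega] yields the sets
    [L n = a ∪ ⋃ (m ∈ n), ⋃ (L m)]; their union is transitive. *)
Lemma transitive_cover (a : M) : exists t, transitive t /\ subset a t.
Proof.
  set (step (n f z : M) := z ∈ a \/ exists m, m ∈ n /\ exists y, y ∈ ap f m /\ z ∈ y).
  assert (bounded : forall n f, exists y, forall z, z ∈ y <-> step n f z).
  { intros n f.
    apply (exists_bounded _ (bigunion (upair a (bigunion (bigunion (bigunion (bigunion f))))))).
    - intros z [h|(m & _ & y & hy & hz)]; apply in_bigunion.
      + exists a. rewrite in_upair. auto.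
      + eexists. rewrite in_upair. split; [right; reflexivity|].
        apply in_ap in hy. destruct hy as (b & hb & hy). apply opair_bound in hb.
        apply in_bigunion. exists y. split; [|exact hz].
        apply in_bigunion. exists b. tauto.
    - unfold step. dfn. }
  set (L n f := setof (step n f)).
  assert (dL : DefT (fun rho => L (rho 0) (rho 1))).
  { apply (DefT_setof (fun rho => step (rho 0) (rho 1))); [auto|]. unfold step. dfn. }
  pose proof (Def_rec_approx L dL) as dA.
  assert (total : forall n, n ∈ omega -> exists! v, exists f t,
    rec_approx L f t /\ n ∈ t /\ v = ap f n).
  { intros n hn. destruct (rec_approx_covers L dL omega omega_transitive n hn) as (f & t & hf & k).
    exists (ap f n). split; [eauto|]. intros v (f' & t' & hf' & k' & ->).
    rewrite (rec_approx_ap L f t), (rec_approx_ap L f' t') by assumption.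
    now apply (rec_approx_unique L _ t _ t'). }
  destruct (replace_rel (fun n v => exists f t, rec_approx L f t /\ n ∈ t /\ v = ap f n) omega)
    as [T hT]; [dfn | exact total|].
  assert (key : forall n f t z, rec_approx L f t -> n ∈ t -> z ∈ ap f n <->
    z ∈ a \/ exists m, m ∈ n /\ exists y, y ∈ ap f m /\ z ∈ y).
  { intros n f t z (tt & ff & df & ef) hn. rewrite ap_app by congruence. rewrite ef by exact hn.
    unfold L. rewrite setof_spec by apply bounded. unfold step.
    assert (s : subset n (dom f)) by (rewrite df; now apply tt).
    apply or_iff_compat_l. split; intros (m & hm & k); exists m; split; auto; revert k;
      rewrite !ap_app, app_restrict; auto using is_fun_restrict;
      rewrite in_dom_restrict; auto. }
  exists (bigunion T). split.
  - intros y hy z hz. apply in_bigunion in hy. destruct hy as (v & hv & hy).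
    apply hT in hv. destruct hv as (n & hn & f & t & hf & k & ->).
    destruct (rec_approx_covers L dL omega omega_transitive (succ n)) as (f' & t' & hf' & k').
    { now apply succ_omega. }
    apply in_bigunion. exists (ap f' (succ n)). split.
    + apply hT. exists (succ n). split; [now apply succ_omega|]. now exists f', t'.
    + apply (key _ _ t'); auto. right. exists n. split; [apply in_succ; auto|].
      exists y. split; [|exact hz].
      assert (nt : n ∈ t') by (apply (proj1 hf' (succ n) k'), in_succ; auto).
      replace (ap f' n) with (ap f n); [exact hy|].
      rewrite (rec_approx_ap L f t), (rec_approx_ap L f' t') by assumption.
      now apply (rec_approx_unique L _ t _ t').
  - intros z hz. destruct (rec_approx_covers L dL omega omega_transitive emptyset zero_omega)
      as (f & t & hf & k).
    apply in_bigunion. exists (ap f emptyset). split.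
    + apply hT. exists emptyset. split; [apply zero_omega|]. now exists f, t.
    + apply (key _ _ t); auto.
Qed.

(** A transitive set around [x] turns the failure of a definable predicate into a nonempty set. *)
Lemma mem_ind (P : M -> Prop) : Def (fun rho => P (rho 0)) ->
  (forall x, (forall y, y ∈ x -> P y) -> P x) -> forall x, P x.
Proof.
  intros d h x. apply NNPP. intro nx.
  destruct (transitive_cover (upair x x)) as (t & tt & ht).
  destruct (foundation M zfc (sub t (fun x => ~ P x))) as (y & hy & my).
  - exists x. apply in_sub; [dfn|]. split; [|exact nx]. apply ht, in_upair. auto.
  - apply in_sub in hy; [|dfn]. destruct hy as [yt ny]. apply ny, h. intros z hz.
    apply NNPP. intro nz. apply (my z hz), in_sub; [dfn|]. split; [now apply (tt y) | exact nz].
Qed.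

Lemma in_trcl (x z : M) :
  z ∈ trcl x <-> forall t, transitive t -> subset x t -> z ∈ t.
Proof.
  apply (setof_spec (fun z => forall t, transitive t -> subset x t -> z ∈ t)).
  destruct (transitive_cover x) as (t & tt & ht). apply (exists_bounded _ t).
  - auto.
  - unfold transitive, subset. dfn.
Qed.
Lemma DefT_trcl (x : (nat -> M) -> M) : DefT x -> DefT (fun rho => trcl (x rho)).
Proof.
  apply (DefT_subst1 trcl),
    (DefT_setof (fun rho z => forall t, transitive t -> subset (rho 0) t -> z ∈ t)).
  - intro rho. exists (trcl (rho 0)). apply in_trcl.
  - unfold transitive, subset. dfn.
Qed.
Hint Resolve DefT_trcl : dfn.

(** * Recursion on the universe *)
(** The step functions [H] of interest apply [app] to the previous values and are not definable as
    functions on the universe.  They agree with a definable [H'] on functions whose values are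
    themselves values of [H'], and only such functions occur in the recursion. *)
Section Recursion.
Context (H H' : M -> M -> M) (hH' : DefT (fun rho => H' (rho 0) (rho 1))).
Context (agree : forall x f, is_fun f -> dom f = x ->
  (forall b, b ∈ x -> exists y g, app f b = H' y g) -> H x f = H' x f).

Lemma rec_approx_agree f t : rec_approx H f t <-> rec_approx H' f t.
Proof.
  assert (loc : transitive t -> is_fun f -> dom f = t -> forall x, x ∈ t ->
    (forall y, y ∈ x -> app f y = H' y (restrict f y)) ->
    H x (restrict f x) = H' x (restrict f x)).
  { intros tt ff df x hx k.
    assert (s : subset x (dom f)) by (rewrite df; now apply tt).
    apply agree; [now apply is_fun_restrict | now apply dom_restrict|].
    intros b hb. rewrite app_restrict, k; eauto. }
  split; intros (tt & ff & df & ef); repeat (split; [assumption|]).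
  - intros x hx. apply NNPP. intro ne.
    destruct (foundation M zfc (sub t (fun x => ap f x <> H' x (restrict f x)))) as (y & hy & my).
    { exists x. apply in_sub; [dfn|]. rewrite ap_app by congruence. auto. }
    apply in_sub in hy; [|dfn]. destruct hy as [yt ny]. apply ny.
    rewrite ap_app by congruence. rewrite ef by exact yt.
    apply loc; auto. intros z hz. apply NNPP. intro nz. apply (my z hz).
    assert (zt : z ∈ t) by now apply (tt y).
    apply in_sub; [dfn|]. split; [exact zt|]. now rewrite ap_app by congruence.
  - intros x hx. rewrite ef by exact hx. symmetry. apply loc; auto.
    intros y hy. apply ef. now apply (tt x).
Qed.

Lemma rec_value f t x : rec_approx H' f t -> x ∈ t -> rec H x = app f x.
Proof.
  intros hf hx. apply the_eq. intro v. split.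
  - intros (f' & t' & hf' & hx' & ->). apply rec_approx_agree in hf'.
    now apply (rec_approx_unique H' _ t' _ t).
  - intros ->. exists f, t. now rewrite rec_approx_agree.
Qed.
Lemma rec_value_ex x : exists f t, rec_approx H' f t /\ x ∈ t.
Proof.
  destruct (transitive_cover (upair x x)) as (t & tt & ht).
  apply (rec_approx_covers H' hH' t tt), ht, in_upair. auto.
Qed.

Lemma DefT_rec (a : (nat -> M) -> M) : DefT a -> DefT (fun rho => rec H (a rho)).
Proof.
  apply (DefT_subst1 (rec H)). unfold DefT.
  pose proof (Def_rec_approx H' hH') as dA.
  apply (Def_iff (fun rho => exists f t, rec_approx H' f t /\ rho 1 ∈ t /\ rho 0 = ap f (rho 1))).
  - dfn.
  - intro rho. split.
    + intros (f & t & hf & k & ->). rewrite (rec_value f t) by auto.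
      now apply (rec_approx_ap H' f t).
    + intros ->. destruct (rec_value_ex (rho 1)) as (f & t & hf & k).
      exists f, t. repeat (split; [assumption|]). rewrite (rec_value f t) by auto. symmetry.
      now apply (rec_approx_ap H' f t).
Qed.

Lemma rec_eq x : rec H x = H' x (lam x (rec H)).
Proof.
  destruct (rec_value_ex x) as (f & t & hf & k). rewrite (rec_value f t) by auto.
  pose proof hf as (tt & ff & df & ef). rewrite ef by exact k. f_equal.
  assert (s : subset x (dom f)) by (rewrite df; now apply tt).
  assert (d : DefT (fun rho => rec H (rho 0))) by (apply DefT_rec; dfn).
  apply fun_ext.
  - now apply is_fun_restrict.
  - now apply is_fun_lam.
  - now rewrite dom_lam, dom_restrict.
  - intros a ha. rewrite dom_restrict in ha by exact s.
    rewrite app_restrict, app_lam; auto. symmetry. apply (rec_value f t); auto.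
    now apply (tt x).
Qed.

Lemma ap_lam_rec x b : b ∈ x -> ap (lam x (rec H)) b = rec H b.
Proof.
  intro hb. assert (d : DefT (fun rho => rec H (rho 0))) by (apply DefT_rec; dfn).
  rewrite ap_app, app_lam; auto using is_fun_lam. now rewrite dom_lam.
Qed.
End Recursion.

Lemma DefT_image (a : (nat -> M) -> M) F : DefT a ->
  DefT (fun rho => F (fun i => rho (S i)) (rho 0)) -> DefT (fun rho => image (a rho) (F rho)).
Proof.
  intros ha hF.
  apply (DefT_setof (fun rho y => exists x, x ∈ a rho /\ y = F rho x)).
  - intro rho. apply (replace_fun (F rho)). exact (DefT_close2 F hF rho).
  - apply (Def_ex (fun rho x => x ∈ a (fun i => rho (S i)) /\ rho 0 = F (fun i => rho (S i)) x)).
    assert (DefT (fun rho => a (fun i => rho (S (S i))))).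
    { apply (Def_subst _ (fun i => match i with 0 => inl 0 | S j => inl (S (S (S j))) end)) in ha.
      exact ha. }
    assert (DefT (fun rho => F (fun i => rho (S (S i))) (rho 0))).
    { apply (Def_subst _ (fun i => match i with 0 => inl 0 | 1 => inl 1
         | S (S j) => inl (S (S (S j))) end)) in hF.
      exact hF. }
    dfn.
Qed.
Hint Resolve DefT_image : dfn.

(** * Ranks *)
Definition rank_step (x f : M) : M := bigunion (image x (fun b => succ (ap f b))).
Definition rank : M -> M := rec rank_step.

Lemma DefT_rank_step : DefT (fun rho => rank_step (rho 0) (rho 1)).
Proof. unfold rank_step. dfn. Qed.
Lemma DefT_rank (x : (nat -> M) -> M) : DefT x -> DefT (fun rho => rank (x rho)).
Proof. apply (DefT_rec rank_step rank_step); auto using DefT_rank_step. Qed.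
Hint Resolve DefT_rank : dfn.
Lemma in_rank x z : z ∈ rank x <-> exists b, b ∈ x /\ z ∈ succ (rank b).
Proof.
  unfold rank. rewrite (rec_eq rank_step rank_step) by auto using DefT_rank_step.
  fold rank. unfold rank_step at 1. rewrite in_bigunion.
  assert (v : forall b, b ∈ x -> ap (lam x rank) b = rank b).
  { apply (ap_lam_rec rank_step rank_step); auto using DefT_rank_step. }
  split.
  - intros (y & hy & hz). apply in_image in hy; [|dfn]. destruct hy as (b & hb & ->).
    rewrite v in hz by exact hb. eauto.
  - intros (b & hb & hz). exists (succ (rank b)). split; [|exact hz].
    apply in_image; [dfn|]. exists b. now rewrite v.
Qed.
Lemma rank_mem x b : b ∈ x -> rank b ∈ rank x.
Proof. intro h. apply in_rank. exists b. rewrite in_succ. auto. Qed.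
Lemma ordinal_rank x : ordinal (rank x).
Proof.
  revert x. apply mem_ind; [unfold ordinal, transitive, subset; dfn|].
  intros x h. split.
  - intros z hz w hw. apply in_rank in hz. destruct hz as (b & hb & hz).
    apply in_rank. exists b. split; [exact hb|]. apply in_succ. left.
    apply in_succ in hz. destruct hz as [hz| ->]; [|exact hw].
    now apply (proj1 (h b hb) z).
  - intros z hz. apply in_rank in hz. destruct hz as (b & hb & hz).
    apply in_succ in hz. destruct hz as [hz| ->];
      [exact (proj2 (h b hb) z hz) | exact (proj1 (h b hb))].
Qed.

(** Induction along rank also reaches elements of elements, such as the values of a function. *)
Lemma rank_ind (Q : M -> Prop) : Def (fun rho => Q (rho 0)) ->
  (forall x, (forall y, rank y ∈ rank x -> Q y) -> Q x) -> forall x, Q x.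
Proof.
  intros d h.
  assert (k : forall a x, rank x = a -> Q x).
  { apply (mem_ind (fun a => forall x, rank x = a -> Q x)); [dfn|].
    intros a IH x <-. apply h. intros y hy. now apply (IH (rank y)). }
  intro x. now apply (k (rank x)).
Qed.
Lemma rank_ap (f a z : M) : z ∈ ap f a -> rank z ∈ rank f.
Proof.
  intro h. apply in_ap in h. destruct h as (b & hb & hz).
  assert (trans : forall u v w, rank u ∈ rank v -> v ∈ w -> rank u ∈ rank w).
  { intros u v w hu hv. apply (proj1 (ordinal_rank w) (rank v)); [now apply rank_mem | exact hu]. }
  apply (trans z (opair a b)); [|exact hb].
  apply (trans z (upair a b)); [|apply in_upair; auto].
  apply (trans z b); [now apply rank_mem | apply in_upair; auto].
Qed.

(** * The hereditarily finite sets *)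
Definition cumulative_step (x f : M) : M := bigunion (image x (fun b => pow (ap f b))).
Definition cumulative : M -> M := rec cumulative_step.

Lemma DefT_cumulative_step : DefT (fun rho => cumulative_step (rho 0) (rho 1)).
Proof. unfold cumulative_step. dfn. Qed.
Lemma in_cumulative x z : z ∈ cumulative x <-> exists b, b ∈ x /\ subset z (cumulative b).
Proof.
  unfold cumulative. rewrite (rec_eq cumulative_step cumulative_step)
    by auto using DefT_cumulative_step.
  fold cumulative. unfold cumulative_step at 1. rewrite in_bigunion.
  assert (v : forall b, b ∈ x -> ap (lam x cumulative) b = cumulative b).
  { apply (ap_lam_rec cumulative_step cumulative_step); auto using DefT_cumulative_step. }
  split.
  - intros (y & hy & hz). apply in_image in hy; [|dfn]. destruct hy as (b & hb & ->).
    rewrite v in hz by exact hb. apply in_pow in hz. eauto.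
  - intros (b & hb & hz). exists (pow (cumulative b)). split; [|now apply in_pow].
    apply in_image; [dfn|]. exists b. now rewrite v.
Qed.
Lemma cumulative_mono x y : subset x y -> subset (cumulative x) (cumulative y).
Proof.
  intros h z. rewrite !in_cumulative. intros (b & hb & k). exists b. auto.
Qed.

(** What makes [cumulative omega] a bound for the hereditarily finite sets. *)
Lemma cumulative_adjoin u v w : u ∈ cumulative omega -> v ∈ cumulative omega ->
  (forall z, z ∈ w <-> z ∈ u \/ z = v) -> w ∈ cumulative omega.
Proof.
  rewrite !in_cumulative. intros (m & hm & km) (n & hn & kn) hw.
  assert (K : exists k, k ∈ omega /\ subset m k /\ subset (succ n) k).
  { pose proof (succ_omega n hn) as hn'.
    destruct (nat_total m (succ n) hm hn') as [h|[h|h]].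
    - exists (succ n). repeat split; auto; [|now intros z].
      now apply (nat_transitive _ hn').
    - exists m. repeat split; auto; [|subst m]; intros z; auto.
    - exists m. repeat split; auto; [now intros z|]. now apply (nat_transitive _ hm). }
  destruct K as (k & hk & mk & nk). exists k. split; [exact hk|].
  intros z hz. apply hw in hz. destruct hz as [hz| ->].
  - apply (cumulative_mono m k mk), km, hz.
  - apply (cumulative_mono _ _ nk), in_cumulative. exists n. rewrite in_succ. auto.
Qed.

Lemma trcl_transitive (x : M) : transitive (trcl x).
Proof.
  intros y hy z hz. rewrite in_trcl in *. intros t tt ht. now apply (tt y (hy t tt ht)).
Qed.
Lemma subset_trcl (x : M) : subset x (trcl x).
Proof. intros z hz. apply in_trcl. intros t _ h. now apply h. Qed.

(** The predicate [V_omega] describes is bounded by a set, so that [V_omega] exists.  Along an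
    enumeration of [trcl x], each subset of [trcl x] with elements in [cumulative omega] is
    built by adjoining one element at a time, hence it is in [cumulative omega].  So there is no
    ∈-minimal element of [trcl x] outside. *)
Lemma hereditarily_finite_cumulative (x : M) : finite (trcl x) -> x ∈ cumulative omega.
Proof.
  intros (n & f & hn & ff & df & enum & _).
  assert (closed : forall y, subset y (trcl x) -> (forall z, z ∈ y -> z ∈ cumulative omega) ->
    y ∈ cumulative omega).
  { intros y hy ky.
    set (part m := sub y (fun z => exists i, i ∈ m /\ opair i z ∈ f)).
    assert (in_part : forall m z, z ∈ part m <-> z ∈ y /\ exists i, i ∈ m /\ opair i z ∈ f).
    { intros m z. apply (in_sub y (fun z => exists i, i ∈ m /\ opair i z ∈ f)). dfn. }
    assert (all : forall m, m ∈ omega -> part m ∈ cumulative omega).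
    { apply omega_ind; [unfold part; dfn| |].
      - apply in_cumulative. exists emptyset. split; [apply zero_omega|].
        intros z hz. apply in_part in hz. destruct hz as (_ & i & hi & _).
        now apply in_empty in hi.
      - intros m hm IH.
        destruct (classic (exists z, z ∈ y /\ opair m z ∈ f)) as [(v & hv & kv)|no].
        + apply (cumulative_adjoin (part m) v); auto. intro z. rewrite !in_part. split.
          * intros (hz & i & hi & k). apply in_succ in hi. destruct hi as [hi| ->]; eauto.
            right. now apply (proj2 ff m).
          * intros [(hz & i & hi & k)| ->]; split; auto.
            -- exists i. rewrite in_succ. auto.
            -- exists m. rewrite in_succ. auto.
        + replace (part (succ m)) with (part m); [exact IH|].
          apply ext. intro z. rewrite !in_part. split; intros (hz & i & hi & k); split; auto.
          * exists i. rewrite in_succ. auto.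
          * apply in_succ in hi. destruct hi as [hi| ->]; eauto. destruct no. eauto. }
    replace y with (part n); [now apply all|].
    apply ext. intro z. rewrite in_part. split; [tauto|]. intro hz. split; [exact hz|].
    destruct (proj1 (enum z) (hy z hz)) as (i & hi & <-). exists i. split; [exact hi|].
    apply app_in; [exact ff | now rewrite df]. }
  apply closed; [apply subset_trcl|].
  intros z hz. apply NNPP. intro nz.
  destruct (foundation M zfc (sub (trcl x) (fun z => ~ z ∈ cumulative omega))) as (y & hy & my).
  { exists z. apply in_sub; [dfn|]. split; [now apply subset_trcl | exact nz]. }
  apply in_sub in hy; [|dfn]. destruct hy as [yt ny]. apply ny, closed.
  - now apply trcl_transitive.
  - intros w hw. apply NNPP. intro nw. apply (my w hw), in_sub; [dfn|].
    split; [now apply (trcl_transitive x y) | exact nw].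
Qed.

Lemma in_V_omega (x : M) : x ∈ V_omega <-> finite (trcl x).
Proof.
  apply (setof_spec (fun x => finite (trcl x))).
  apply (exists_bounded _ (cumulative omega)); [apply hereditarily_finite_cumulative|].
  apply (Def_iff (fun rho => exists n f, n ∈ omega /\ is_fun f /\ dom f = n /\
    (forall y, y ∈ trcl (rho 0) <-> exists i, i ∈ n /\ ap f i = y) /\
    (forall i j, i ∈ n -> j ∈ n -> ap f i = ap f j -> i = j))).
  - unfold is_fun. dfn.
  - intro rho. unfold finite. split; intros (n & f & hn & ff & df & e & inj); exists n, f;
      repeat (split; [assumption|]); split.
    + intro y. rewrite e. split; intros (i & hi & k); exists i; split; auto;
        rewrite ap_app in * by congruence; auto.
    + intros i j hi hj. rewrite <- !ap_app by congruence. auto.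
    + intro y. rewrite e. split; intros (i & hi & k); exists i; split; auto;
        rewrite ap_app in * by congruence; auto.
    + intros i j hi hj. rewrite !ap_app by congruence. auto.
Qed.

Lemma omega_V_omega (n : M) : n ∈ omega -> n ∈ V_omega.
Proof.
  intro hn. apply in_V_omega. pose proof (nat_transitive n hn) as tn.
  replace (trcl n) with n.
  - assert (d : DefT (fun rho : nat -> M => rho 0)) by dfn.
    exists n, (lam n (fun i => i)). split; [exact hn|]. split; [now apply is_fun_lam|].
    split; [now apply dom_lam|]. split.
    + intro y. split; [intro hy; exists y; split; auto; now apply (app_lam n (fun i => i))|].
      intros (i & hi & <-). now rewrite (app_lam n (fun i => i)).
    + intros i j hi hj. now rewrite !(app_lam n (fun i => i)).
  - apply ext. intro z. rewrite in_trcl. split; [intros hz t _ h; now apply h|].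
    intro h. apply h; [exact tn|]. now intros w.
Qed.

(** * Names over a definable frame *)
Lemma fun_bounded (x A B : M) : is_fun x ->
  (forall a b, opair a b ∈ x -> a ∈ A /\ b ∈ B) -> x ∈ pow (pow (pow (bigunion (upair A B)))).
Proof.
  intros [pairs _] h. apply in_pow. intros z hz. apply in_pow. intros w hw. apply in_pow.
  intros v hv. destruct (pairs z hz) as (a & b & ->). destruct (h a b hz) as [ha hb].
  assert (k : v = a \/ v = b).
  { apply in_upair in hw. destruct hw; subst w; apply in_upair in hv; tauto. }
  apply in_bigunion. destruct k as [->| ->]; [exists A | exists B]; rewrite in_upair; auto.
Qed.

Section Frame.
Context (P : frame M) (dle : Def (fun rho => le P (rho 0) (rho 1))).
Context (le_refl : forall p, p ∈ nodes P -> le P p p)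
  (le_trans : forall p q r, le P p q -> le P q r -> le P p r)
  (bot_node : bot P ∈ nodes P) (le_bot : forall p, p ∈ nodes P -> le P (bot P) p).

Lemma in_up p q : q ∈ up P p <-> q ∈ nodes P /\ le P p q.
Proof. apply (setof_spec (fun q => q ∈ nodes P /\ le P p q)), separate. dfn. Qed.
Lemma DefT_up (p : (nat -> M) -> M) : DefT p -> DefT (fun rho => up P (p rho)).
Proof.
  apply (DefT_subst1 (up P)), (DefT_setof (fun rho q => q ∈ nodes P /\ le P (rho 0) q)).
  - intro rho. exists (up P (rho 0)). apply in_up.
  - dfn.
Qed.
Hint Resolve DefT_up : dfn.
Lemma DefT_tau (r x : (nat -> M) -> M) : DefT r -> DefT x -> DefT (fun rho => tau P (r rho) (x rho)).
Proof. apply (DefT_subst2 (tau P)). unfold tau. dfn. Qed.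
Hint Resolve DefT_tau : dfn.

Lemma up_node p q : q ∈ up P p -> q ∈ nodes P.
Proof. intro h. now apply in_up in h. Qed.
Lemma up_refl p : p ∈ nodes P -> p ∈ up P p.
Proof. intro h. apply in_up. auto. Qed.
Lemma up_trans p q r : q ∈ up P p -> r ∈ up P q -> r ∈ up P p.
Proof. rewrite !in_up. intros [] []. eauto. Qed.
Lemma up_bot : up P (bot P) = nodes P.
Proof. apply ext. intro q. rewrite in_up. split; [tauto|auto]. Qed.
Hint Resolve up_node up_refl up_trans : core.

Definition on p x : Prop := is_fun x /\ dom x = up P p.

Lemma ap_on p x r : on p x -> r ∈ up P p -> ap x r = app x r.
Proof. intros [] h. apply ap_app; congruence. Qed.
Lemma on_tau p x r : on p x -> r ∈ up P p -> on r (tau P r x).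
Proof.
  intros [hx dx] h. split; [now apply is_fun_restrict|].
  apply dom_restrict. intros s hs. rewrite dx. eauto.
Qed.
Lemma app_tau p x r s : on p x -> r ∈ up P p -> s ∈ up P r -> app (tau P r x) s = app x s.
Proof. intros [hx dx] h k. apply app_restrict; auto. rewrite dx. eauto. Qed.
Lemma tau_tau r s x : s ∈ up P r -> tau P s (tau P r x) = tau P s x.
Proof.
  intro h. apply ext. intro z. unfold tau. rewrite !in_restrict. split.
  - tauto.
  - intros (hz & a & b & ha & e). repeat split; eauto 6.
Qed.
Lemma tau_self p x : on p x -> tau P p x = x.
Proof.
  intros [hx dx]. apply ext. intro z. unfold tau. rewrite in_restrict. split; [tauto|].
  intro hz. split; [exact hz|]. destruct (proj1 hx z hz) as (a & b & ->). exists a, b.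
  split; [|reflexivity]. rewrite <- dx. apply in_dom. eauto.
Qed.
Lemma on_ext p x y : on p x -> on p y -> (forall r, r ∈ up P p -> app x r = app y r) -> x = y.
Proof. intros [hx dx] [hy dy] h. apply fun_ext; try congruence. now rewrite dx. Qed.

(** * Canonical names *)
Definition check_step (x f : M) : M :=
  lam (nodes P) (fun p => image x (fun b => tau P p (ap f b))).
Lemma DefT_check_step : DefT (fun rho => check_step (rho 0) (rho 1)).
Proof. unfold check_step. dfn. Qed.
Lemma check_step_agrees (x f : M) : is_fun f -> dom f = x ->
  lam (nodes P) (fun p => setof (fun y => exists b, b ∈ x /\ y = tau P p (app f b))) =
  check_step x f.
Proof.
  intros hf df. apply lam_congr. intros p _. apply setof_ext. intro y.
  split; intros (b & hb & ->); exists b; rewrite ap_app by congruence; auto.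
Qed.
Lemma DefT_check (x : (nat -> M) -> M) : DefT x -> DefT (fun rho => check P (x rho)).
Proof.
  apply (DefT_rec _ check_step DefT_check_step). intros y f hf df _.
  now apply check_step_agrees.
Qed.
Hint Resolve DefT_check : dfn.
Lemma check_eq a : check P a = lam (nodes P) (fun p => image a (fun b => tau P p (check P b))).
Proof.
  unfold check at 1. rewrite (rec_eq _ check_step DefT_check_step)
    by (intros; now apply check_step_agrees).
  apply lam_congr. intros p _. apply setof_ext. intro y.
  split; intros (b & hb & ->); exists b; (split; [exact hb|]); f_equal;
    [|symmetry]; apply (ap_lam_rec _ check_step DefT_check_step); auto;
    intros; now apply check_step_agrees.
Qed.
Lemma on_check a : on (bot P) (check P a).
Proof.
  rewrite check_eq. split; [apply is_fun_lam; dfn|]. rewrite up_bot. apply dom_lam. dfn.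
Qed.
Lemma in_check a p y : p ∈ nodes P ->
  y ∈ app (check P a) p <-> exists b, b ∈ a /\ y = tau P p (check P b).
Proof. intro hp. rewrite check_eq, app_lam by (dfn || auto). apply in_image. dfn. Qed.
Lemma app_tau_check a r s : r ∈ nodes P -> s ∈ up P r ->
  app (tau P r (check P a)) s = app (check P a) s.
Proof. intro h. apply (app_tau (bot P)); [apply on_check | now rewrite up_bot]. Qed.
Lemma on_tau_check a r : r ∈ nodes P -> on r (tau P r (check P a)).
Proof. intro h. apply (on_tau (bot P)); [apply on_check | now rewrite up_bot]. Qed.
Lemma tau_check_mem a r s y : r ∈ nodes P -> s ∈ up P r -> y ∈ app (check P a) r ->
  tau P s y ∈ app (check P a) s.
Proof.
  intros hr hs hy. apply in_check in hy; [|exact hr]. destruct hy as (b & hb & ->).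
  apply in_check; eauto. exists b. now rewrite tau_tau.
Qed.

(** * The stages *)
Lemma name_over_ext (W W' : M -> M -> M) a p x :
  (forall b q, b ∈ a -> q ∈ up P p -> W b q = W' b q) ->
  name_over P W a p x <-> name_over P W' a p x.
Proof.
  intro h. unfold name_over. split; intros (hx & dx & k & m);
    repeat (split; [assumption|]); (split; [|exact m]); intros q hq y hy;
    destruct (k q hq y hy) as (b & hb & e); exists b; (split; [exact hb|]);
    [rewrite <- h | rewrite h]; auto.
Qed.

Definition name_set (f a p : M) : M := setof (name_over P (fun b q => ap (ap f b) q) a p).

(** The variables are, in order: the name, the node, the bound [alpha] and the function that gives
    the earlier stages. *)
Lemma Def_name_over :
  Def (fun rho => name_over P (fun b q => ap (ap (rho 3) b) q) (rho 2) (rho 1) (rho 0)).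
Proof.
  apply (Def_iff (fun rho => is_fun (rho 0) /\ dom (rho 0) = up P (rho 1) /\
    (forall q, q ∈ up P (rho 1) -> forall y, y ∈ ap (rho 0) q ->
      exists b, b ∈ rho 2 /\ y ∈ ap (ap (rho 3) b) q) /\
    (forall q r, q ∈ up P (rho 1) -> r ∈ up P q -> forall y, y ∈ ap (rho 0) q ->
      tau P r y ∈ ap (rho 0) r))).
  - unfold is_fun. dfn.
  - intro rho. split; intros (hx & dx & k & m); repeat (split; [assumption|]); split.
    + intros q hq y hy. apply (k q hq). now rewrite (ap_on (rho 1)).
    + intros q r hq hr y hy. rewrite <- (ap_on (rho 1)) by (try split; eauto).
      apply (m q); auto. now rewrite (ap_on (rho 1)).
    + intros q hq y hy. apply (k q hq). now rewrite <- (ap_on (rho 1)).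
    + intros q r hq hr y hy. rewrite (ap_on (rho 1)) by (try split; eauto).
      apply (m q); auto. now rewrite <- (ap_on (rho 1)).
Qed.
(** The values of a name at this stage are subsets of one set [U], because the nodes form a set. *)
Lemma name_set_ex f a p : exists y, forall x,
  x ∈ y <-> name_over P (fun b q => ap (ap f b) q) a p x.
Proof.
  set (U := bigunion (image a (fun b => bigunion (image (nodes P) (fun q => ap (ap f b) q))))).
  apply (exists_bounded _ (pow (pow (pow (bigunion (upair (nodes P) (pow U))))))).
  - intros x (hx & dx & k & _). apply fun_bounded; [exact hx|].
    intros q v hv. assert (hq : q ∈ up P p) by (rewrite <- dx; apply in_dom; eauto).
    split; [eauto|]. apply in_pow. intros y hy. destruct (k q hq y) as (b & hb & e).
    { now rewrite (app_eq x q v). }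
    apply in_bigunion. exists (bigunion (image (nodes P) (fun q => ap (ap f b) q))). split.
    + apply in_image; [dfn | eauto].
    + apply in_bigunion. exists (ap (ap f b) q). split; [|exact e].
      apply in_image; [dfn | eauto].
  - pose proof Def_name_over as d.
    apply (Def_subst _ (fun i => match i with
      0 => inl 0 | 1 => inr p | 2 => inr a | _ => inr f end)) in d. exact d.
Qed.
Lemma DefT_name_set : DefT (fun rho => name_set (rho 2) (rho 1) (rho 0)).
Proof.
  apply (DefT_setof (fun rho => name_over P (fun b q => ap (ap (rho 2) b) q) (rho 1) (rho 0))).
  - intro rho. apply name_set_ex.
  - apply Def_name_over.
Qed.
Definition stage_step (a f : M) : M := lam (nodes P) (name_set f a).
Lemma DefT_stage_step : DefT (fun rho => stage_step (rho 0) (rho 1)).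
Proof.
  apply (DefT_lam (fun _ => nodes P) (fun rho => name_set (rho 1) (rho 0))); [dfn|].
  apply DefT_name_set.
Qed.
Lemma DefT_name_set1 f a : DefT (fun rho => name_set f a (rho 0)).
Proof.
  pose proof DefT_name_set as d.
  apply (Def_subst _ (fun i => match i with
    0 => inl 0 | 1 => inl 1 | 2 => inr a | _ => inr f end)) in d. exact d.
Qed.
Lemma stage_step_agrees (a f : M) : is_fun f -> dom f = a ->
  (forall b, b ∈ a -> exists y g, app f b = stage_step y g) ->
  lam (nodes P) (fun p => setof (name_over P (fun b q => app (app f b) q) a p)) =
  stage_step a f.
Proof.
  intros hf df v. apply lam_congr. intros p _. apply setof_ext. intro x.
  apply name_over_ext. intros b q hb hq. rewrite (ap_app f b) by congruence.
  destruct (v b hb) as (y & g & ->). symmetry. unfold stage_step.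
  apply ap_app; [apply is_fun_lam | rewrite dom_lam]; eauto using DefT_name_set1.
Qed.
Lemma DefT_V_stage (a : (nat -> M) -> M) : DefT a -> DefT (fun rho => V_stage P (a rho)).
Proof. apply (DefT_rec _ stage_step DefT_stage_step), stage_step_agrees. Qed.
Hint Resolve DefT_V_stage : dfn.
Lemma V_stage_eq a : V_stage P a = stage_step a (lam a (V_stage P)).
Proof.
  unfold V_stage at 1. now rewrite (rec_eq _ stage_step DefT_stage_step) by exact stage_step_agrees.
Qed.
Lemma ap_V_stage a p : p ∈ nodes P -> ap (V_stage P a) p = app (V_stage P a) p.
Proof.
  intro hp. rewrite V_stage_eq. unfold stage_step.
  apply ap_app; [apply is_fun_lam | rewrite dom_lam]; auto using DefT_name_set1.
Qed.
Lemma in_V_stage a p x : p ∈ nodes P ->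
  x ∈ app (V_stage P a) p <-> name_over P (fun b q => app (V_stage P b) q) a p x.
Proof.
  intro hp. rewrite V_stage_eq at 1. unfold stage_step.
  rewrite app_lam by auto using DefT_name_set1. unfold name_set.
  rewrite setof_spec by apply name_set_ex. apply name_over_ext. intros b q hb hq.
  rewrite <- ap_V_stage by eauto. f_equal.
  assert (d : DefT (fun rho => V_stage P (rho 0))) by dfn.
  rewrite ap_app; [now apply app_lam | now apply is_fun_lam | now rewrite dom_lam].
Qed.

Lemma name_over_tau W a p x r : name_over P W a p x -> r ∈ up P p -> name_over P W a r (tau P r x).
Proof.
  intros (hx & dx & k & m) hr. assert (o : on p x) by now split.
  destruct (on_tau p x r o hr) as [hx' dx']. repeat (split; [assumption|]). split.
  - intros q hq y hy. rewrite (app_tau p) in hy by auto. apply (k q); eauto.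
  - intros q s hq hs y hy. rewrite (app_tau p) in * by eauto. apply (m q); eauto.
Qed.
(** Passing to fewer elements does not raise the stage. *)
Lemma name_over_shrink W a p x r z : name_over P W a p x -> r ∈ up P p -> on r z ->
  (forall q, q ∈ up P r -> subset (app z q) (app x q)) ->
  (forall q s, q ∈ up P r -> s ∈ up P q -> forall y, y ∈ app z q -> tau P s y ∈ app z s) ->
  name_over P W a r z.
Proof.
  intros (hx & dx & k & m) hr [hz dz] s mz. repeat (split; [assumption|]). split; [|exact mz].
  intros q hq y hy. apply (k q); eauto. now apply s.
Qed.

(** Ranks serve as stages, since the elements of [a] have ranks in [rank a]. *)
Lemma check_stage a : check P a ∈ ap (V_stage P (rank a)) (bot P).
Proof.
  revert a. apply mem_ind; [dfn|]. intros a IH.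
  rewrite ap_V_stage by exact bot_node. apply in_V_stage; [exact bot_node|].
  destruct (on_check a) as [h d]. repeat (split; [assumption|]). split.
  - intros q hq y hy. apply in_check in hy; [|eauto]. destruct hy as (b & hb & ->).
    exists (rank b). split; [now apply rank_mem|]. specialize (IH b hb).
    rewrite ap_V_stage in IH by exact bot_node. apply in_V_stage in IH; [|exact bot_node].
    apply in_V_stage; [eauto|]. now apply (name_over_tau _ _ (bot P)).
  - intros q r hq hr y hy. apply (tau_check_mem _ q); eauto.
Qed.
Lemma V_frame_check a : V_frame P (bot P) (check P a).
Proof.
  exists (rank a). split; [apply ordinal_rank|].
  rewrite <- ap_V_stage by exact bot_node. apply check_stage.
Qed.
Lemma V_frame_tau p x r : p ∈ nodes P -> r ∈ up P p -> V_frame P p x -> V_frame P r (tau P r x).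
Proof.
  intros hp hr (a & ha & hx). exists a. split; [exact ha|].
  apply in_V_stage in hx; [|exact hp]. apply in_V_stage; [eauto|].
  now apply (name_over_tau _ _ p).
Qed.
Lemma V_frame_on p x : p ∈ nodes P -> V_frame P p x -> on p x.
Proof. intros hp (a & _ & hx). apply in_V_stage in hx; [|exact hp]. split; apply hx. Qed.
Lemma V_frame_mem_on p x r v : p ∈ nodes P -> V_frame P p x -> r ∈ up P p -> v ∈ app x r -> on r v.
Proof.
  intros hp (a & _ & hx) hr hv. apply in_V_stage in hx; [|exact hp].
  destruct hx as (_ & _ & k & _). destruct (k r hr v hv) as (b & _ & hb).
  apply in_V_stage in hb; [|eauto]. split; apply hb.
Qed.
Lemma V_frame_mono p x r s v : p ∈ nodes P -> V_frame P p x -> r ∈ up P p -> s ∈ up P r ->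
  v ∈ app x r -> tau P s v ∈ app x s.
Proof.
  intros hp (a & _ & hx) hr hs hv. apply in_V_stage in hx; [|exact hp].
  now apply (proj2 (proj2 (proj2 hx)) r).
Qed.
Lemma V_frame_shrink p x r z : p ∈ nodes P -> V_frame P p x -> r ∈ up P p -> on r z ->
  (forall q, q ∈ up P r -> subset (app z q) (app x q)) ->
  (forall q s, q ∈ up P r -> s ∈ up P q -> forall y, y ∈ app z q -> tau P s y ∈ app z s) ->
  V_frame P r z.
Proof.
  intros hp (a & ha & hx) hr oz s m. apply in_V_stage in hx; [|exact hp].
  exists a. split; [exact ha|]. apply in_V_stage; [eauto|].
  now apply (name_over_shrink _ a p x).
Qed.

(** What [p] forces when it forces [~ ~ z ∈ x]. *)
Definition densely_in (x p z : M) : Prop :=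
  forall r, r ∈ up P p -> exists s, s ∈ up P r /\ tau P s z ∈ app x s.

(** * No set contains every name that is densely in [V_omega] *)
(** A node satisfying [L s k] has left the spine at position [k]; the spine consists of the nodes
    above [q] at which this has not happened.  The hypotheses say that leaving is permanent and
    possible above every node, and that for each [m] the spine has points beyond which every
    departure is at a position after [m]. *)
Section Spine.
Context (q : M) (L : M -> M -> Prop) (dL : Def (fun rho => L (rho 0) (rho 1))).
Definition spine p : Prop := p ∈ up P q /\ forall k, ~ L p k.
Context (hq : q ∈ nodes P)
  (L_omega : forall s k, L s k -> k ∈ omega)
  (L_up : forall s t k, L s k -> t ∈ up P s -> L t k)
  (L_unique : forall s k k', L s k -> L s k' -> k = k')
  (L_dense : forall r, r ∈ up P q -> exists s k, s ∈ up P r /\ L s k)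
  (spine_root : forall k, ~ L q k)
  (L_unbounded : forall m p, m ∈ omega -> spine p -> exists p', p' ∈ up P p /\ spine p' /\
     forall s k, s ∈ up P p' -> L s k -> m ∈ k).
Context (y : M) (hy : V_frame P q y) (y_contains : forall p z, p ∈ up P q -> V_frame P p z ->
  densely_in (check P V_omega) p z -> z ∈ app y p).

Let on_y : on q y := V_frame_on q y hq hy.

Lemma tau_check_in_y n s : n ∈ omega -> s ∈ up P q -> tau P s (check P n) ∈ app y s.
Proof.
  intros hn hs. apply y_contains; auto.
  - apply (V_frame_tau (bot P)); auto using V_frame_check. rewrite up_bot. eauto.
  - intros r hr. exists r. split; [eauto|]. rewrite tau_tau by exact hr.
    apply in_check; [eauto|]. exists n. split; [now apply omega_V_omega | reflexivity].
Qed.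
Lemma check_subset_y n s : n ∈ omega -> s ∈ up P q -> subset (app (check P n) s) (app y s).
Proof.
  intros hn hs v hv. apply in_check in hv; [|eauto]. destruct hv as (m & hm & ->).
  apply tau_check_in_y; auto. now apply (omega_transitive n).
Qed.

Definition off s : Prop := exists k, L s k.
Lemma Def_off (s : (nat -> M) -> M) : DefT s -> Def (fun rho => off (s rho)).
Proof. apply (Def_subst1 off). unfold off. dfn. Qed.
Hint Resolve Def_off : dfn.
Lemma off_up s t : off s -> t ∈ up P s -> off t.
Proof. intros [k h] ht. exists k. eauto. Qed.

Section Closure.
Context (p : M) (hp : p ∈ up P q) (R : M -> M -> Prop)
  (dR : Def (fun rho => R (rho 0) (rho 1))).
(** The largest part of [y] with [R] as prescription off the spine. *)
Definition closure : M := lam (up P p) (fun r =>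
  sub (ap y r) (fun v => forall s, s ∈ up P r -> off s -> R s (tau P s v))).

Lemma on_closure : on p closure.
Proof. split; [apply is_fun_lam | apply dom_lam]; dfn. Qed.
Lemma in_closure r v : r ∈ up P p -> v ∈ app closure r <->
  v ∈ app y r /\ forall s, s ∈ up P r -> off s -> R s (tau P s v).
Proof.
  intro hr. unfold closure. rewrite app_lam by (dfn || auto). rewrite in_sub by dfn.
  now rewrite (ap_on q) by eauto.
Qed.
Lemma V_frame_closure : V_frame P p closure.
Proof.
  apply (V_frame_shrink q y); auto using on_closure.
  - intros r hr v hv. now apply in_closure in hv.
  - intros r s hr hs v hv. apply in_closure in hv; [|exact hr]. destruct hv as [hv k].
    apply in_closure; [eauto|]. split.
    + apply (V_frame_mono q y r); eauto.
    + intros t ht ot. rewrite tau_tau by exact ht. eauto.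
Qed.
Lemma closure_saturated r v : r ∈ up P p -> v ∈ app y r ->
  (forall s, s ∈ up P r -> off s -> tau P s v ∈ app closure s) -> v ∈ app closure r.
Proof.
  intros hr hv k. apply in_closure; [exact hr|]. split; [exact hv|].
  intros s hs os. specialize (k s hs os). apply in_closure in k; [|eauto].
  rewrite <- (tau_tau s s) by eauto. apply k; eauto.
Qed.
(** Off the spine, [closure] is what [R] prescribes: there, [R] at [s] settles [R] at all later
    nodes, and the canonical name of a natural number is included in [y]. *)
Lemma tau_closure s n : s ∈ up P p -> off s -> n ∈ omega ->
  (forall t v, t ∈ up P s -> v ∈ app y t -> R t v <-> v ∈ app (check P n) t) ->
  tau P s closure = tau P s (check P n).
Proof.
  intros hs os hn e. apply (on_ext s).
  - apply (on_tau p); auto using on_closure.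
  - apply on_tau_check. eauto.
  - intros t ht. rewrite (app_tau p), app_tau_check by eauto using on_closure.
    assert (tp : t ∈ up P p) by eauto. assert (tq : t ∈ up P q) by eauto.
    apply ext. intro v. rewrite in_closure by exact tp. split.
    + intros [hv k]. apply e; auto. specialize (k t). rewrite (tau_self t) in k.
      * apply k; eauto using off_up.
      * now apply (V_frame_mem_on q y).
    + intro hv. assert (vy : v ∈ app y t) by now apply (check_subset_y n).
      split; [exact vy|]. intros r hr _. apply e; [eauto| |].
      * apply (V_frame_mono q y t); eauto.
      * apply (tau_check_mem n t); eauto.
Qed.
(** Since the nodes off the spine are dense, values there decide dense membership. *)
Lemma closure_in_y : (forall s, s ∈ up P p -> off s -> exists n, n ∈ omega /\
    tau P s closure = tau P s (check P n)) -> closure ∈ app y p.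
Proof.
  intro k. apply y_contains; auto using V_frame_closure.
  intros r hr. destruct (L_dense r) as (s & i & hs & hi); [eauto|].
  exists s. split; [exact hs|]. destruct (k s) as (n & hn & ->); [eauto | now exists i|].
  apply in_check; [eauto|]. exists n. split; [now apply omega_V_omega | reflexivity].
Qed.
End Closure.

Definition tends_to_infinity p u : Prop :=
  forall m p1, m ∈ omega -> p1 ∈ up P p -> spine p1 -> exists p2, p2 ∈ up P p1 /\ spine p2 /\
    forall s, s ∈ up P p2 -> off s ->
      exists n, n ∈ omega /\ m ∈ n /\ tau P s u = tau P s (check P n).
Definition saturated p u : Prop := forall r v, r ∈ up P p -> v ∈ ap y r ->
  (forall s, s ∈ up P r -> off s -> tau P s v ∈ ap u s) -> v ∈ ap u r.
(** The node [p] is existentially bound, as it is determined by the domain of [u]. *)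
Definition unfounded u : Prop := exists p, spine p /\ u ∈ ap y p /\
  tends_to_infinity p u /\ saturated p u.

Lemma Def_unfounded : Def (fun rho => unfounded (rho 0)).
Proof. unfold unfounded, tends_to_infinity, saturated, spine. dfn. Qed.

Lemma closure_saturated_ap p R : p ∈ up P q -> Def (fun rho => R (rho 0) (rho 1)) ->
  saturated p (closure p R).
Proof.
  intros hp dR r v hr hv k. pose proof (on_closure p R dR) as o.
  rewrite (ap_on p) by auto. apply closure_saturated; auto.
  - now rewrite <- (ap_on q) by eauto.
  - intros s hs os. rewrite <- (ap_on p) by eauto. auto.
Qed.

(** The number prescribed off the spine is the position of departure. *)
Lemma exists_unfounded : exists u, unfounded u.
Proof.
  set (R s v := forall k, L s k -> v ∈ ap (check P k) s).
  assert (dR : Def (fun rho => R (rho 0) (rho 1))) by (unfold R; dfn).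
  assert (hqq : q ∈ up P q) by eauto.
  assert (value : forall s k, s ∈ up P q -> L s k ->
    tau P s (closure q R) = tau P s (check P k)).
  { intros s k hs hk. apply tau_closure; eauto; [now exists k|].
    intros t v ht hv. unfold R.
    assert (e : ap (check P k) t = app (check P k) t).
    { apply (ap_on (bot P)); [apply on_check|]. rewrite up_bot. eauto. }
    split.
    - intro h. rewrite <- e. eauto.
    - intros h k' hk'. rewrite (L_unique t k' k); eauto. now rewrite e. }
  exists (closure q R), q. split; [now split|]. split; [|split].
  - rewrite (ap_on q) by auto. apply closure_in_y; auto.
    intros s hs [k hk]. exists k. eauto.
  - intros m p1 hm hp1 sp1. destruct (L_unbounded m p1 hm sp1) as (p2 & hp2 & sp2 & h).
    exists p2. repeat (split; [assumption|]). intros s hs [k hk]. exists k.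
    split; [eauto|]. split; [eauto|]. apply value; [|exact hk].
    apply (up_trans _ p1); eauto.
  - now apply closure_saturated_ap.
Qed.

Lemma omega_cases (n m : M) : n ∈ omega -> m ∈ n -> exists j, j ∈ omega /\ n = succ j.
Proof.
  intro hn. revert n hn m.
  apply (omega_ind (fun n => forall m, m ∈ n -> exists j, j ∈ omega /\ n = succ j)); [dfn| |].
  - intros m hm. now apply in_empty in hm.
  - intros n hn _ m _. eauto.
Qed.

(** The prescription is the union of the values of [u].  If [u] is the canonical name of [succ j] at
    an off-spine node, then this union is the canonical name of [j], which is a member of [u]
    there; by saturation of [u] the closure is a member of [u] on the spine as well. *)
Lemma unfounded_descends u : unfounded u -> exists p u', unfounded u' /\ u' ∈ ap u p.
Proof.
  intros (p & sp & hu & inf & sat_u).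
  (* Beyond [p'], the number that [u] equals off the spine is positive. *)
  destruct (inf emptyset p zero_omega) as (p' & hp' & sp' & pos); auto.
  { apply up_refl. destruct sp. eauto. }
  assert (pq : p ∈ up P q) by apply sp.
  assert (pq' : p' ∈ up P q) by apply sp'.
  rewrite (ap_on q) in hu by auto.
  assert (ou : on p u) by now apply (V_frame_mem_on q y).
  set (R s v := exists v', v' ∈ ap u s /\ v ∈ ap v' s).
  assert (dR : Def (fun rho => R (rho 0) (rho 1))) by (unfold R; dfn).
  assert (value : forall s j, s ∈ up P p' -> off s -> j ∈ omega ->
    tau P s u = tau P s (check P (succ j)) -> tau P s (closure p' R) = tau P s (check P j)).
  { intros s j hs os hj e. apply tau_closure; auto. intros t v ht hv.
    assert (et : ap u t = app (check P (succ j)) t).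
    { rewrite (ap_on p) by eauto. rewrite <- (app_tau p u s t), e by eauto.
      apply app_tau_check; eauto. }
    assert (tn : t ∈ nodes P) by eauto. unfold R. rewrite et.
    assert (ev : forall m, ap (tau P t (check P m)) t = app (check P m) t).
    { intro m. rewrite (ap_on t), app_tau_check; auto using on_tau_check. }
    split.
    - intros (v' & hv' & k). apply in_check in hv'; [|exact tn].
      destruct hv' as (m & hm & ->). rewrite ev in k.
      apply in_check in k; [|exact tn]. destruct k as (l & hl & ->).
      apply in_check; [exact tn|]. exists l. split; [|reflexivity].
      apply in_succ in hm. destruct hm as [hm| ->]; [|exact hl].
      now apply (nat_transitive j hj m).
    - intro k. exists (tau P t (check P j)). rewrite ev. split; [|exact k].
      apply in_check; [exact tn|]. exists j. rewrite in_succ. auto. }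
  assert (pred : forall s, s ∈ up P p' -> off s -> exists j, j ∈ omega /\
    tau P s u = tau P s (check P (succ j))).
  { intros s hs os. destruct (pos s hs os) as (n & hn & h0 & e).
    destruct (omega_cases n _ hn h0) as (j & hj & ->). eauto. }
  assert (wy : closure p' R ∈ app y p').
  { apply closure_in_y; auto. intros s hs os. destruct (pred s hs os) as (j & hj & e).
    exists j. auto. }
  exists p', (closure p' R). split.
  - exists p'. split; [exact sp'|]. rewrite (ap_on q) by auto. split; [exact wy|]. split.
    + intros m p1 hm hp1 sp1.
      (* The predecessor exceeds [m] as soon as the number itself exceeds [succ m]. *)
      destruct (inf (succ m) p1) as (p2 & hp2 & sp2 & k); eauto using succ_omega.
      exists p2. repeat (split; [assumption|]). intros s hs os.
      destruct (k s hs os) as (n & hn & hmn & e).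
      destruct (omega_cases n _ hn hmn) as (j & hj & ->). exists j.
      split; [exact hj|]. split; [|apply value; auto; apply (up_trans _ p1); eauto].
      apply in_succ in hmn. destruct hmn as [h| <-].
      * apply (nat_transitive j hj _ h), in_succ. auto.
      * apply in_succ. auto.
    + now apply closure_saturated_ap.
  - apply sat_u; auto. { now rewrite (ap_on q). }
    intros s hs os. destruct (pred s hs os) as (j & hj & e).
    rewrite (value s j) by auto. rewrite (ap_on p) by eauto.
    rewrite <- (app_tau p u s s), e by eauto. rewrite app_tau_check by eauto.
    apply in_check; [eauto|]. exists j. rewrite in_succ. auto.
Qed.

Lemma spine_contradiction : False.
Proof.
  assert (none : forall u, ~ unfounded u).
  { pose proof Def_unfounded as d. apply rank_ind; [dfn|]. intros u IH hu.
    destruct (unfounded_descends u hu) as (p & u' & hu' & k).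
    exact (IH u' (rank_ap u p u' k) hu'). }
  destruct exists_unfounded as [u hu]. exact (none u hu).
Qed.
End Spine.

(** * Forcing [NDCom] *)
(** With [check V_omega] as the witness for [NDCom], both sentences deny that a name contains all
    [z] with [~ ~ z ∈ check V_omega]: a double complement would, by one half of its defining
    equivalence.  The double negation of an atom is forced where the atom is forced densely. *)
Lemma models_of_no_container :
  (forall q y, q ∈ nodes P -> V_frame P q y -> (forall p z, p ∈ up P q -> V_frame P p z ->
    densely_in (check P V_omega) p z -> z ∈ app y p) -> False) ->
  models P NDCom nil /\ models P no_double_complement (cons (check P V_omega) nil).
Proof.
  intro h. split.
  - exists (check P V_omega). split; [apply V_frame_check|].
    intros q hq y hy q' hq' k. cbn in k. unfold val in k. cbn in k.
    assert (hy' : V_frame P q' (tau P q' y)) by (apply (V_frame_tau q); eauto).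
    apply (h q' (tau P q' y)); eauto. intros p z hp hz dz.
    assert (oz : on p z) by (apply V_frame_on; eauto).
    specialize (k p hp z hz p (up_refl p (up_node _ _ hp))).
    rewrite (tau_self p z oz) in k. rewrite !tau_tau in k by eauto.
    rewrite <- (app_tau q' _ p p) by eauto using V_frame_on. rewrite tau_tau by auto.
    apply k. intros r hr no. destruct (dz r hr) as (s & hs & hsz).
    apply (no s hs). rewrite !tau_tau by eauto. rewrite app_tau_check; eauto.
  - intros q hq (y & hy & k). cbn in k. unfold val in k. cbn in k.
    apply (h q y); eauto. intros p z hp hz dz.
    assert (oz : on p z) by (apply V_frame_on; eauto).
    specialize (k p hp z hz). destruct k as [_ k].
    specialize (k p (up_refl p (up_node _ _ hp))).
    rewrite (tau_self p z oz) in k. rewrite !tau_tau in k by eauto.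
    rewrite <- (app_tau q _ p p) by eauto using V_frame_on.
    apply k. intros r hr no. destruct (dz r hr) as (s & hs & hsz).
    apply (no s hs). rewrite !tau_tau by eauto. rewrite app_tau_check; eauto.
Qed.
End Frame.

(** * The binary tree *)
Lemma in_cantor_nodes (s : M) : s ∈ nodes (cantor_tree M) <->
  is_fun s /\ dom s ∈ omega /\ forall i b, opair i b ∈ s -> b ∈ two.
Proof.
  transitivity (exists n, n ∈ omega /\ is_fun s /\ dom s = n /\ forall i, i ∈ n -> app s i ∈ two).
  - apply (setof_spec (fun s => exists n, n ∈ omega /\ is_fun s /\ dom s = n /\
      forall i, i ∈ n -> app s i ∈ two)).
    apply (exists_bounded _ (pow (pow (pow (bigunion (upair omega two)))))).
    + intros x (n & hn & fx & dx & v). apply fun_bounded; [exact fx|].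
      intros i b h. assert (hi : i ∈ n) by (rewrite <- dx; apply in_dom; eauto).
      split; [now apply (omega_transitive n)|]. rewrite <- (app_eq x i b fx h). auto.
    + apply (Def_iff (fun rho => exists n, n ∈ omega /\ is_fun (rho 0) /\ dom (rho 0) = n /\
        forall i, i ∈ n -> ap (rho 0) i ∈ two)).
      * unfold is_fun. dfn.
      * intro rho. split; intros (n & hn & fx & dx & v); exists n;
          repeat (split; [assumption|]); intros i hi; specialize (v i hi);
          rewrite ap_app in * by congruence; auto.
  - split.
    + intros (n & hn & fs & <- & v). repeat (split; [assumption|]). intros i b h.
      rewrite <- (app_eq s i b fs h). apply v, in_dom. eauto.
    + intros (fs & ds & v). exists (dom s). repeat (split; [auto; fail|]).
      intros i hi. apply (v i). now apply app_in.
Qed.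

Definition extends (s t : M) : Prop := s = restrict t (dom s).
Lemma extends_spec (s t : M) : is_fun s -> is_fun t ->
  extends s t <-> forall z, z ∈ s -> z ∈ t.
Proof.
  intros hs ht. split.
  - intros e z hz. rewrite e in hz. now apply in_restrict in hz.
  - intro h. apply ext. intro z. rewrite in_restrict. split.
    + intro hz. split; [auto|]. destruct (proj1 hs z hz) as (a & b & ->). exists a, b.
      split; [apply in_dom; eauto | reflexivity].
    + intros (hz & a & b & ha & ->). apply in_dom in ha. destruct ha as [b' hb'].
      now rewrite (proj2 ht a b b' hz (h _ hb')).
Qed.
Lemma extends_refl (s : M) : is_fun s -> extends s s.
Proof. intro h. now apply extends_spec. Qed.
Lemma extends_trans (s t u : M) : extends s t -> extends t u -> extends s u.
Proof.
  intros est etu. apply ext. intro z. rewrite in_restrict. split.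
  - intro hz. assert (k := hz). rewrite est in k. apply in_restrict in k.
    destruct k as [hz' k]. split; [|exact k].
    rewrite etu in hz'. now apply in_restrict in hz'.
  - intros (hz & a & b & ha & ->). rewrite est. apply opair_restrict. split; [|exact ha].
    rewrite etu. apply opair_restrict. split; [exact hz|].
    apply in_dom in ha. destruct ha as [b' hb']. rewrite est in hb'.
    apply opair_restrict in hb'. apply in_dom. exists b'. tauto.
Qed.

Lemma in_cantor_up (s t : M) : t ∈ up (cantor_tree M) s <->
  t ∈ nodes (cantor_tree M) /\ extends s t.
Proof. apply in_up. simpl. dfn. Qed.

Definition snoc (s d : M) : M := bigunion (upair s (upair (opair (dom s) d) (opair (dom s) d))).
Lemma in_snoc (s d z : M) : z ∈ snoc s d <-> z ∈ s \/ z = opair (dom s) d.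
Proof.
  unfold snoc. rewrite in_bigunion. split.
  - intros (y & hy & hz). apply in_upair in hy. destruct hy; subst; auto.
    apply in_upair in hz. tauto.
  - intros [h| ->]; eexists; rewrite in_upair; split; [left| |right|]; try reflexivity; auto.
    apply in_upair. auto.
Qed.
Lemma dom_snoc (s d : M) : dom (snoc s d) = succ (dom s).
Proof.
  apply ext. intro a. rewrite in_succ, !in_dom. split.
  - intros [b h]. apply in_snoc in h. destruct h as [h|h]; [eauto|].
    apply opair_inj in h. tauto.
  - intros [[b h]| ->]; [exists b | exists d]; apply in_snoc; auto.
Qed.
Lemma snoc_up (s d : M) : s ∈ nodes (cantor_tree M) -> d ∈ two ->
  snoc s d ∈ up (cantor_tree M) s.
Proof.
  intros hs hd. pose proof hs as k. apply in_cantor_nodes in k. destruct k as (fs & ds & v).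
  assert (f : is_fun (snoc s d)).
  { split.
    - intros z hz. apply in_snoc in hz. destruct hz as [hz| ->]; [now apply fs | eauto].
    - intros a b b'. rewrite !in_snoc. intros [h|h] [h'|h'].
      + now apply (proj2 fs a).
      + apply opair_inj in h'. destruct h' as [-> _]. destruct (mem_irrefl (dom s)).
        apply in_dom. eauto.
      + apply opair_inj in h. destruct h as [-> _]. destruct (mem_irrefl (dom s)).
        apply in_dom. eauto.
      + apply opair_inj in h, h'. destruct h, h'. congruence. }
  apply in_cantor_up. split.
  - apply in_cantor_nodes. split; [exact f|]. split.
    + rewrite dom_snoc. now apply succ_omega.
    + intros i b h. apply in_snoc in h. destruct h as [h|h]; [eauto|].
      apply opair_inj in h. destruct h as [_ ->]. exact hd.
  - apply extends_spec; auto. intros z hz. apply in_snoc. auto.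
Qed.

(** * The branch of zeros above a node *)
Section Branch.
Context (q : M) (hq : q ∈ nodes (cantor_tree M)).
Definition marked (s i : M) : Prop :=
  ~ i ∈ dom q /\ exists b, opair i b ∈ s /\ b <> emptyset.
(** The first nonzero digit beyond [q] is the position at which [s] leaves the branch [q, 0, 0, ...]. *)
Definition first_mark (s k : M) : Prop :=
  s ∈ nodes (cantor_tree M) /\ marked s k /\ forall i, i ∈ k -> ~ marked s i.

Lemma Def_first_mark : Def (fun rho => first_mark (rho 0) (rho 1)).
Proof. unfold first_mark, marked. dfn. Qed.
Lemma marked_dom s i : marked s i -> i ∈ dom s.
Proof. intros (_ & b & h & _). apply in_dom. eauto. Qed.
Lemma marked_up s t i : t ∈ up (cantor_tree M) s -> s ∈ nodes (cantor_tree M) ->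
  marked s i -> marked t i.
Proof.
  intros ht hs (ni & b & h & nb). split; [exact ni|]. exists b. split; [|exact nb].
  apply in_cantor_up in ht. destruct ht as [ht e].
  apply (proj1 (extends_spec s t ltac:(now apply in_cantor_nodes in hs)
    ltac:(now apply in_cantor_nodes in ht)) e _ h).
Qed.
Lemma marked_down s t i : t ∈ up (cantor_tree M) s -> i ∈ dom s -> marked t i -> marked s i.
Proof.
  intros ht hi (ni & b & h & nb). split; [exact ni|]. exists b. split; [|exact nb].
  apply in_cantor_up in ht. destruct ht as [ht e]. rewrite e. now apply opair_restrict.
Qed.
Lemma node_dom s : s ∈ nodes (cantor_tree M) -> dom s ∈ (omega : M).
Proof. intro h. now apply in_cantor_nodes in h. Qed.

Lemma first_mark_ex s i : s ∈ nodes (cantor_tree M) -> marked s i -> exists k, first_mark s k.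
Proof.
  intros hs hi.
  assert (d : Def (fun rho => marked s (rho 0))) by (unfold marked; dfn).
  destruct (foundation M zfc (sub (dom s) (marked s))) as (k & hk & mk).
  { exists i. apply in_sub; [exact d|]. auto using marked_dom. }
  apply in_sub in hk; [|exact d]. destruct hk as [ks hk]. exists k.
  repeat (split; [assumption|]). intros j hj hm. apply (mk j hj), in_sub; [exact d|].
  auto using marked_dom.
Qed.
Lemma first_mark_omega s k : first_mark s k -> k ∈ omega.
Proof.
  intros (hs & hk & _). apply (omega_transitive (dom s)); auto using node_dom, marked_dom.
Qed.
Lemma first_mark_up s t k : first_mark s k -> t ∈ up (cantor_tree M) s -> first_mark t k.
Proof.
  intros (hs & hk & least) ht. split; [now apply in_cantor_up in ht|].
  split; [now apply (marked_up s)|]. intros i hi hm. apply (least i hi).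
  apply (marked_down s t); auto.
  apply (nat_transitive (dom s) (node_dom s hs) k); auto using marked_dom.
Qed.
Lemma first_mark_unique s k k' : first_mark s k -> first_mark s k' -> k = k'.
Proof.
  intros h h'. destruct (nat_total k k') as [e|[e|e]]; eauto using first_mark_omega.
  - destruct h' as (_ & _ & least). destruct (least k e). apply h.
  - destruct h as (_ & _ & least). destruct (least k' e). apply h'.
Qed.
Lemma first_mark_dense r : r ∈ up (cantor_tree M) q ->
  exists s k, s ∈ up (cantor_tree M) r /\ first_mark s k.
Proof.
  intro hr. apply in_cantor_up in hr. destruct hr as [hr e].
  assert (hs : snoc r (succ emptyset) ∈ up (cantor_tree M) r).
  { apply snoc_up; [exact hr|]. apply in_succ. auto. }
  exists (snoc r (succ emptyset)).
  destruct (first_mark_ex (snoc r (succ emptyset)) (dom r)) as [k hk]; [|split|eauto].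
  - now apply in_cantor_up in hs.
  - intro h. apply (mem_irrefl (dom r)). rewrite e in h. now apply in_dom_restrict in h.
  - exists (succ emptyset). rewrite in_snoc. split; [auto|]. intro k.
    apply (in_empty emptyset). rewrite <- k at 2. apply in_succ. auto.
Qed.

Lemma unmarked_snoc p : p ∈ up (cantor_tree M) q -> (forall k, ~ first_mark p k) ->
  forall k, ~ first_mark (snoc p emptyset) k.
Proof.
  intros hp no k (_ & (nk & b & hb & nb) & _).
  apply in_snoc in hb. destruct hb as [hb|hb].
  - destruct (first_mark_ex p k) as [j hj].
    + now apply in_cantor_up in hp.
    + split; eauto.
    + exact (no j hj).
  - apply opair_inj in hb. tauto.
Qed.
(** Appending zeros to [p] stays on the branch, and beyond length [m] only positions above [m] are
    left for the first nonzero digit. *)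
Lemma first_mark_unbounded m p : m ∈ omega -> spine (cantor_tree M) q first_mark p ->
  exists p', p' ∈ up (cantor_tree M) p /\ spine (cantor_tree M) q first_mark p' /\
    forall s k, s ∈ up (cantor_tree M) p' -> first_mark s k -> m ∈ k.
Proof.
  intros hm [hp no].
  assert (long : exists p', p' ∈ up (cantor_tree M) p /\ (forall k, ~ first_mark p' k) /\
    m ∈ dom p').
  { assert (step : forall p', p' ∈ up (cantor_tree M) p -> (forall k, ~ first_mark p' k) ->
      snoc p' emptyset ∈ up (cantor_tree M) p /\
      forall k, ~ first_mark (snoc p' emptyset) k).
    { intros p' hp' no'.
      assert (hs : snoc p' emptyset ∈ up (cantor_tree M) p').
      { apply snoc_up; [now apply in_cantor_up in hp'|]. apply in_succ. left.
        apply in_succ. auto. }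
      apply in_cantor_up in hp, hp', hs. destruct hp as [hp e], hp' as [hp' e'], hs as [hs e''].
      split.
      - apply in_cantor_up. split; [exact hs|]. now apply (extends_trans p p').
      - apply unmarked_snoc; [|exact no']. apply in_cantor_up. split; [exact hp'|].
        now apply (extends_trans q p). }
    assert (np : p ∈ nodes (cantor_tree M)) by now apply in_cantor_up in hp.
    assert (pp : p ∈ up (cantor_tree M) p).
    { apply in_cantor_up. split; [exact np|]. apply extends_refl.
      now apply in_cantor_nodes in np. }
    pose proof Def_first_mark as d.
    revert m hm. apply omega_ind.
    - assert (d' : Def (fun rho => rho 0 ∈ up (cantor_tree M) p)) by dfn. dfn.
    - destruct (step p pp no) as [h h']. exists (snoc p emptyset).
      repeat (split; [assumption|]). rewrite dom_snoc. now apply zero_mem_succ, node_dom.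
    - intros m hm (p' & hp' & no' & hmp). destruct (step p' hp' no') as [h h'].
      exists (snoc p' emptyset). repeat (split; [assumption|]). rewrite dom_snoc.
      apply succ_mem; [|exact hmp]. apply node_dom. now apply in_cantor_up in hp'. }
  destruct long as (p' & hp' & no' & hmp). exists p'. split; [exact hp'|].
  assert (np' : p' ∈ nodes (cantor_tree M)) by now apply in_cantor_up in hp'.
  split.
  - split; [|exact no']. apply in_cantor_up in hp, hp'. apply in_cantor_up. split; [exact np'|].
    now apply (extends_trans q p).
  - intros s k hs hk.
    assert (nk : ~ k ∈ dom p').
    { intro h. destruct (first_mark_ex p' k np') as [j hj]; [|exact (no' j hj)].
      apply (marked_down p' s); auto. apply hk. }
    destruct (nat_total m k) as [h|[h|h]]; eauto using first_mark_omega.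
    + destruct nk. now rewrite <- h.
    + destruct nk. now apply (nat_transitive (dom p') (node_dom p' np') m).
Qed.
End Branch.

Lemma cantor_models : models (cantor_tree M) NDCom nil /\
  models (cantor_tree M) no_double_complement (cons (check (cantor_tree M) V_omega) nil).
Proof.
  assert (is_fun_node : forall s, s ∈ nodes (cantor_tree M) -> is_fun s).
  { intros s hs. now apply in_cantor_nodes in hs. }
  assert (dle : Def (fun rho => le (cantor_tree M) (rho 0) (rho 1))) by (simpl; dfn).
  assert (refl : forall p, p ∈ nodes (cantor_tree M) -> le (cantor_tree M) p p).
  { intros p hp. now apply extends_refl, is_fun_node. }
  assert (bot_le : forall p, p ∈ nodes (cantor_tree M) -> le (cantor_tree M) emptyset p).
  { intros p hp. apply ext. intro z. rewrite in_restrict, in_empty. split; [tauto|].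
    intros (_ & a & b & h & _). apply in_dom in h. destruct h as [c h]. now apply in_empty in h. }
  assert (empty_node : emptyset ∈ nodes (cantor_tree M)).
  { apply in_cantor_nodes. split; [split|split].
    - intros z hz. now apply in_empty in hz.
    - intros a b b' h. now apply in_empty in h.
    - replace (dom emptyset) with (emptyset : M); [apply zero_omega|].
      apply ext. intro a. rewrite in_dom. split.
      + intro h. now apply in_empty in h.
      + intros [b h]. now apply in_empty in h.
    - intros i b h. now apply in_empty in h. }
  apply models_of_no_container; auto; [exact extends_trans|].
  intros q y hq hy contains.
  apply (spine_contradiction (cantor_tree M) dle refl extends_trans empty_node bot_le q
    (first_mark q) (Def_first_mark q) hq) with (y := y);
    auto using first_mark_dense, first_mark_unbounded.
  - intros s k. apply first_mark_omega.
  - intros s t k. apply first_mark_up.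
  - intros s k k'. apply first_mark_unique.
  - intros k (_ & hk & _). apply hk. now apply (marked_dom q).
Qed.
End Sets.

Theorem theorem5p6 (M : structure) (zfc : ZFC M) :
  models (cantor_tree M) NDCom nil /\
  models (cantor_tree M) no_double_complement
    (cons (check (cantor_tree M) V_omega) nil).
Proof. exact (cantor_models zfc). Qed.
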